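(* Let $k$ be algebraically closed of characteristic $0$ and $\mathcal A$ the $N=2$ conformal superalgebra. Up to isomorphism of $k$-conformal superalgebras there are exactly two twisted loop algebras of $\mathcal A$, namely $\mathcal L(\mathcal A,\mathrm{id})=\mathcal A\otimes_kR$ and $\mathcal L(\mathcal A,\omega)$, where $\omega$ is the order-two automorphism of $\mathcal A$ with $L\mapsto L$, $J\mapsto-J$, $G^+\mapsto G^-$, $G^-\mapsto G^+$. Furthermore, every $\widehat{\mathcal S}/\mathcal R$-form of $\mathcal A\otimes_k\mathcal R$ is isomorphic (as $\mathcal R$-conformal superalgebra) to one of these two loop algebras, and these two are not isomorphic.
   Context: Notation: $R=k[t^{\pm1}]$, $S_m=k[t^{\pm1/m}]$, $\widehat S=k[t^q:q\in\mathbb Q]$, $\delta_t=d/dt$, $\mathcal R=(R,\delta_t)$, $\widehat{\mathcal S}=(\widehat S,\delta_t)$; fixed compatible primitive roots of unity $\xi_m\in k$. Over a differential ring $(R,\delta_R)$, a conformal superalgebra is a $\mathbb Z/2\mathbb Z$-graded $R$-module with parity-preserving $k$-linear $\partial$ and $k$-bilinear products $a_{(n)}b$ satisfying $a_{(n)}b=0$ for $n\gg0$, $(\partial a)_{(n)}b=-na_{(n-1)}b$, $a_{(n)}\partial b=\partial(a_{(n)}b)+na_{(n-1)}b$, $\partial(ra)=r\partial a+\delta_R(r)a$, $a_{(n)}(rb)=r(a_{(n)}b)$, $(ra)_{(n)}b=\sum_j\frac1{j!}\delta_R^j(r)(a_{(n+j)}b)$; homomorphisms are even $R$-linear maps preserving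 $n$-products and commuting with $\partial$. Base change $\mathcal B\otimes_{\mathcal R}\mathcal S$: $\partial\otimes1+1\otimes\delta_S$, $(a\otimes r)_{(n)}(b\otimes s)=\sum_j(a_{(n+j)}b)\otimes\frac1{j!}\delta_S^j(r)s$. An $\widehat{\mathcal S}/\mathcal R$-form of $\mathcal B$ is an $\mathcal R$-conformal superalgebra $\mathcal F$ with $\mathcal F\otimes_{\mathcal R}\widehat{\mathcal S}\cong\mathcal B\otimes_{\mathcal R}\widehat{\mathcal S}$. The $N=2$ conformal superalgebra is $\mathcal A=k[\partial]\otimes V$, $V_{\bar0}=kL\oplus kJ$, $V_{\bar1}=kG^+\oplus kG^-$, with $\lambda$-brackets ($[a_\lambda b]=\sum\frac{\lambda^n}{n!}a_{(n)}b$) $[L_\lambda L]=(\partial+2\lambda)L$, $[L_\lambda J]=(\partial+\lambda)J$, $[L_\lambda G^\pm]=(\partial+\frac32\lambda)G^\pm$, $[J_\lambda J]=0$, $[J_\lambda G^\pm]=\pm G^\pm$, $[G^\pm{}_\lambda G^\pm]=0$, $[G^+{}_\lambda G^-]=L+\frac12(\partial+2\lambda)J$ (others by skew-symmetry). For a $k$-conformal automorphism $\sigma$ of $\mathcal A$ with $\sigma^m=\mathrm{id}$, set $\mathcal A_i=\{x:\sigma x=\xi_m^ix\}$ and $\mathcal L(\mathcal A,\sigma)=\bigoplus_{i\in\mathbb Z}\mathcal A_i\otimes t^{i/m}\subseteq\mathcal A\otimes_kS_m$ (twisted loop algebra), an $\mathcal R$-conformal superalgebra (with derivation $\partial\otimes1+1\otimes\delta_t$),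 hence also a $k$-conformal superalgebra by restriction. *)

(* Defs.v *)
From HB Require Import structures.
From mathcomp Require Import all_boot all_algebra.
From mathcomp Require Import finmap monalg.
Set Implicit Arguments. Unset Strict Implicit. Unset Printing Implicit Defensive.
Import GRing.Theory.
Local Open Scope fset.
Local Open Scope ring_scope.

Definition laurent (R : comNzRingType) : predArgType := malg int R.
Section LaurentRing.
Context (R : comNzRingType).
HB.instance Definition _ := GRing.Lmodule.on (laurent R).
Implicit Types (g : {malg R[int]}) (k : int).

Definition lgone : {malg R[int]} := << 1 *g (0 : int) >>.
Definition lgmul g1 g2 : {malg R[int]} :=
  \sum_(k1 <- msupp g1) \sum_(k2 <- msupp g2) << g1@_k1 * g2@_k2 *g (k1 + k2)%R >>.

Lemma lgmullw (d1 d2 : {fset int}) g1 g2 :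
  msupp g1 `<=` d1 -> msupp g2 `<=` d2 ->
  lgmul g1 g2 = \sum_(k1 <- d1) \sum_(k2 <- d2) << g1@_k1 * g2@_k2 *g (k1 + k2)%R >>.
Proof.
move=> le_d1 le_d2; rewrite /lgmul (big_fset_incl _ le_d1) /=.
  apply/eq_bigr=> k1 _; apply/big_fset_incl => // k _ /mcoeff_outdom ->.
  by rewrite mulr0 monalgU0.
move=> k _ /mcoeff_outdom g1k.
by rewrite big1 => // k' _; rewrite g1k mul0r monalgU0.
Qed.

Lemma lgmulrw (d1 d2 : {fset int}) g1 g2 : msupp g1 `<=` d1 -> msupp g2 `<=` d2
  -> lgmul g1 g2 = \sum_(k2 <- d2) \sum_(k1 <- d1) << g1@_k1 * g2@_k2 *g (k1 + k2)%R >>.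
Proof. by move=> le_d1 le_d2; rewrite (lgmullw le_d1 le_d2) exchange_big. Qed.

Lemma lgmul0g : left_zero 0 lgmul.
Proof. by move=> g; rewrite /lgmul msupp0 big_seq_fset0. Qed.

Lemma lgmulg0 : right_zero 0 lgmul.
Proof. by move=> g; rewrite (lgmulrw (fsubset_refl _) (fsubset_refl _)) msupp0 big_seq_fset0. Qed.

Lemma lgmulUg c k g :
  lgmul << c *g k >> g = \sum_(k' <- msupp g) << c * g@_k' *g (k + k')%R >>.
Proof.
rewrite (lgmullw msuppU_le (fsubset_refl _)) big_seq_fset1.
by apply/eq_bigr => k' _; rewrite mcoeffUU.
Qed.

Lemma lgmulgU c k g :
  lgmul g << c *g k >> = \sum_(k' <- msupp g) << g@_k' * c *g (k' + k)%R >>.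
Proof.
rewrite (lgmulrw (fsubset_refl _) msuppU_le) big_seq_fset1.
by apply/eq_bigr=> k' _; rewrite mcoeffUU.
Qed.

Lemma lgmulUU c1 c2 k1 k2 :
  lgmul << c1 *g k1 >> << c2 *g k2 >> = << c1 * c2 *g (k1 + k2)%R >>.
Proof. by rewrite (lgmulrw msuppU_le msuppU_le) !big_seq_fset1 !mcoeffUU. Qed.

Lemma lgmulEl1 g1 g2 :
  lgmul g1 g2 = \sum_(k1 <- msupp g1) lgmul << g1@_k1 *g k1 >> g2.
Proof. by apply/eq_bigr=> k _; rewrite lgmulUg. Qed.

Lemma lgmulEr1 g1 g2 :
  lgmul g1 g2 = \sum_(k2 <- msupp g2) lgmul g1 << g2@_k2 *g k2 >>.
Proof.
rewrite (lgmulrw (fsubset_refl _) (fsubset_refl _)).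
by apply/eq_bigr=> k _; rewrite lgmulgU.
Qed.

Lemma lgmul1g : left_id lgone lgmul.
Proof.
move=> g; rewrite /lgone lgmulUg [RHS]monalgE.
by apply/eq_bigr=> kg _; rewrite mul1r add0r.
Qed.

Lemma lgmulg1 : right_id lgone lgmul.
Proof.
move=> g; rewrite /lgone lgmulgU [RHS]monalgE.
by apply/eq_bigr=> k _; rewrite mulr1 addr0.
Qed.

Lemma lgmulgDl : left_distributive lgmul +%R.
Proof.
move=> g1 g2 g.
rewrite [in RHS](lgmullw (fsubsetUl _ (msupp g2)) (fsubset_refl _)).
rewrite [in RHS](lgmullw (fsubsetUr (msupp g1) _) (fsubset_refl _)).
rewrite (lgmullw (msuppD_le _ _) (fsubset_refl _)).
rewrite -big_split /=; apply/eq_bigr=> k1 _.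
rewrite -big_split /=; apply/eq_bigr=> k2 _.
by rewrite mcoeffD mulrDl monalgUD.
Qed.

Lemma lgmulgDr : right_distributive lgmul +%R.
Proof.
move=> g g1 g2.
rewrite [in RHS](lgmulrw (fsubset_refl _) (fsubsetUl _ (msupp g2))).
rewrite [in RHS](lgmulrw (fsubset_refl _) (fsubsetUr (msupp g1) _)).
rewrite (lgmulrw (fsubset_refl _) (msuppD_le _ _)).
rewrite -big_split /=; apply/eq_bigr => k1 _.
rewrite -big_split /=; apply/eq_bigr => k2 _.
by rewrite mcoeffD mulrDr monalgUD.
Qed.

Lemma lgmulA : associative lgmul.
Proof.
move=> g1 g2 g3.
rewrite [RHS](big_morph (lgmul^~ _) (fun _ _ => lgmulgDl _ _ _) (lgmul0g _)).
rewrite lgmulEl1; apply/eq_bigr=> k1 _.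
rewrite [LHS](big_morph (lgmul _) (fun _ _ => lgmulgDr _ _ _) (lgmulg0 _)).
rewrite [RHS](big_morph (lgmul^~ _) (fun _ _ => lgmulgDl _ _ _) (lgmul0g _)).
apply/eq_bigr=> k2 _.
rewrite [LHS](big_morph (lgmul _) (fun _ _ => lgmulgDr _ _ _) (lgmulg0 _)).
by rewrite lgmulEr1; apply/eq_bigr=> k3 _; rewrite !lgmulUU mulrA addrA.
Qed.

Lemma lgoner_neq0 : lgone != 0.
Proof. by apply/eqP/malgP=> /(_ 0) /eqP; rewrite mcoeffUU mcoeff0 oner_eq0. Qed.

Lemma lgmulC : commutative lgmul.
Proof.
move=> g1 g2; apply/malgP=> k.
rewrite (lgmullw (fsubset_refl _) (fsubset_refl _)) (lgmulrw (fsubset_refl _) (fsubset_refl _)).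
rewrite !raddf_sum; apply/eq_bigr=> k1 _; rewrite !raddf_sum; apply/eq_bigr=> k2 _.
by rewrite mulrC addrC.
Qed.

HB.instance Definition _ := GRing.Zmodule_isNzRing.Build (laurent R)
  lgmulA lgmul1g lgmulg1 lgmulgDl lgmulgDr lgoner_neq0.
HB.instance Definition _ := GRing.Ring_hasCommutativeMul.Build (laurent R) lgmulC.
HB.instance Definition _ := GRing.ComNzRing.on (laurent R).

Lemma lgscaleAl c (g1 g2 : laurent R) : c *: (g1 * g2) = (c *: g1) * g2.
Proof.
apply/malgP=> k; rewrite mcoeffZ.
have E : forall k1, (c *: g1)@_k1 = c * g1@_k1 by move=> k1; apply: mcoeffZ.
rewrite [(c *: g1) * g2](lgmullw (msuppZ_le c g1) (fsubset_refl _)).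
under eq_bigr do under eq_bigr do rewrite E.
rewrite [g1 * g2](lgmullw (fsubset_refl _) (fsubset_refl _)).
rewrite !raddf_sum mulr_sumr; apply/eq_bigr=> k1 _.
rewrite !raddf_sum mulr_sumr; apply/eq_bigr=> k2 _.
by rewrite /= !(@mcoeffU int R) mulrnAr mulrA.
Qed.

HB.instance Definition _ := GRing.Lmodule_isLalgebra.Build R (laurent R) lgscaleAl.
HB.instance Definition _ := GRing.Lalgebra.on (laurent R).
HB.instance Definition _ := GRing.Lalgebra_isComAlgebra.Build R (laurent R).
End LaurentRing.


(* Rings.  R = k[t^{+-1}] is [laurent k] (coefficient of t^z is r@_z).    *)
(* The rational exponents of Ŝ = k[t^q : q in Q] only occur through the   *)
(* ambient module A ⊗_k Ŝ below, represented as finitely supported        *)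
(* functions rat -> A (x = sum_q x@_q ⊗ t^q).                             *)

Section N2.
Variable k : fieldType.

Definition derR (r : laurent k) : laurent k :=
  \sum_(z <- msupp r) << z%:~R * r@_z *g (z - 1)%R >>.

(* K is the ground field (needed for the 1/j! in the axiom on (ra)_(n)b). *)
Definition is_conf (K : fieldType) (R : comAlgType K) (dR : R -> R)
    (V : lmodType R) (par : bool -> V -> Prop) (der : V -> V)
    (npr : nat -> V -> V -> V) : Prop :=
  ((forall b, par b 0) /\
   (forall b (x y : V), par b x -> par b y -> par b (x + y)) /\
   (forall b (r : R) (x : V), par b x -> par b (r *: x)) /\
   (forall x : V, exists x0 x1, [/\ par false x0, par true x1 & x = x0 + x1]) /\
   (forall x : V, par false x -> par true x -> x = 0)) /\
  (forall b x, par b x -> par b (der x)) /\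
  (forall n b c x y, par b x -> par c y -> par (addb b c) (npr n x y)) /\
  (forall x y, der (x + y) = der x + der y) /\
  (forall n x y z, npr n (x + y) z = npr n x z + npr n y z) /\
  (forall n x y z, npr n x (y + z) = npr n x y + npr n x z) /\
  (forall x y, exists N, forall n, (N <= n)%N -> npr n x y = 0) /\
  (forall n x y, npr n (der x) y = - (n%:R *: npr n.-1 x y)) /\
  (forall n x y, npr n x (der y) = der (npr n x y) + n%:R *: npr n.-1 x y) /\
  (forall (r : R) x, der (r *: x) = r *: der x + dR r *: x) /\
  (forall n (r : R) x y, npr n x (r *: y) = r *: npr n x y) /\
  (forall n (r : R) x y N, (forall m, (N <= m)%N -> npr m x y = 0) ->
     npr n (r *: x) y =
       \sum_(j < N) (((j`!)%:R : K)^-1 *: iter j dR r) *: npr (n + j) x y).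

(* An element of A is a 4-tuple of polynomials in ∂, the coefficients of *)
(* the generators L (index 0), J (1), G^+ (2), G^- (3).                  *)
Definition A := {ffun 'I_4 -> {poly k}}.

Definition lam : {poly {poly k}} := 'X.
Definition dd  : {poly {poly k}} := ('X)%:P.
Definition cst (c : k) : {poly {poly k}} := c%:P%:P.
Definition half : k := (2%:R)^-1.
Definition thalf : k := 3%:R / 2%:R.

(* [X_λ Y] = \sum_Z brk X Y Z · Z, as a polynomial in λ (outer) and ∂ (inner) *)
Definition brk (X Y Z : 'I_4) : {poly {poly k}} :=
  match nat_of_ord X, nat_of_ord Y, nat_of_ord Z with
  | 0, 0, 0 => dd + cst 2%:R * lam
  | 0, 1, 1 => dd + lam
  | 0, 2, 2 => dd + cst thalf * lam
  | 0, 3, 3 => dd + cst thalf * lam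
  | 1, 0, 1 => lam
  | 1, 2, 2 => 1
  | 1, 3, 3 => -1
  | 2, 0, 2 => cst half * dd + cst thalf * lam
  | 3, 0, 3 => cst half * dd + cst thalf * lam
  | 2, 1, 2 => -1
  | 3, 1, 3 => 1
  | 2, 3, 0 => 1
  | 2, 3, 1 => cst half * dd + lam
  | 3, 2, 0 => 1
  | 3, 2, 1 => - (cst half * dd) - lam
  | _, _, _ => 0
  end.

Definition liftP (p : {poly k}) : {poly {poly {poly k}}} :=
  map_poly cst p.

(* λ-bracket: [p(∂)X _λ q(∂)Y] = p(-λ) q(λ+∂) [X_λ Y] *)
Definition lbrA (a b : A) (Z : 'I_4) : {poly {poly k}} :=
  \sum_(X < 4) \sum_(Y < 4)
     (liftP (a X)).[- lam] * (liftP (b Y)).[lam + dd] * brk X Y Z.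

Definition nprA (n : nat) (a b : A) : A :=
  [ffun Z => (n`!)%:R *: (lbrA a b Z)`_n].

Definition derA (a : A) : A := [ffun Z => 'X * a Z].

(* parity: false = even (span of L, J), true = odd (span of G+, G-) *)
Definition parA (b : bool) (a : A) : Prop :=
  forall Z : 'I_4, (2 <= Z)%N != b -> a Z = 0.

Definition conf_autA (s : A -> A) : Prop :=
  bijective s /\
  (forall (c : k) a b, s (c *: a + b) = c *: s a + s b) /\
  (forall b a, parA b a -> parA b (s a)) /\
  (forall a, s (derA a) = derA (s a)) /\
  (forall n a b, s (nprA n a b) = nprA n (s a) (s b)).

Definition omegaA (a : A) : A :=
  [ffun Z : 'I_4 => match nat_of_ord Z with
                    | 0 => a (inord 0)
                    | 1 => - a (inord 1)
                    | 2 => a (inord 3)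
                    | _ => a (inord 2) end].

Definition AS := {malg A[rat]}.

(* ∂ ⊗ 1 + 1 ⊗ δ_t, with δ_t(t^q) = q t^(q-1) *)
Definition derS (x : AS) : AS :=
  \sum_(q <- msupp x)
     (<< derA x@_q *g q >> + << ratr q *: x@_q *g (q - 1)%R >>).

(* (1/j!) δ_t^j (t^p) = binr p j · t^(p-j) *)
Definition binr (p : rat) (j : nat) : k :=
  ratr ((\prod_(i < j) (p - i%:R)) / (j`!)%:R).

(* a bound N with a_(m) b = 0 for m >= N (degree bound in λ) *)
Definition bndA (a : A) : nat := \max_(X < 4) size (a X).

(* base-change n-products:
   (a ⊗ t^p)_(n) (b ⊗ t^q) = \sum_j (a_(n+j) b) ⊗ (1/j!) δ^j(t^p) t^q *)
Definition nprS (n : nat) (x y : AS) : AS :=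
  \sum_(p <- msupp x) \sum_(q <- msupp y)
    \sum_(j < bndA x@_p + bndA y@_q + 2)
      << binr p j *: nprA (n + j) x@_p y@_q *g (p + q - j%:R)%R >>.

Definition parS (b : bool) (x : AS) : Prop := forall q, parA b x@_q.

Definition sclS (c : k) (x : AS) : AS :=
  \sum_(q <- msupp x) << c *: x@_q *g q >>.
Definition shS (p : rat) (x : AS) : AS :=
  \sum_(q <- msupp x) << x@_q *g (p + q)%R >>.
Definition rsclS (r : laurent k) (x : AS) : AS :=
  \sum_(z <- msupp r) sclS (r@_z) (shS z%:~R x).

(* L(A,σ) = ⊕_i A_i ⊗ t^(i/m) ⊆ A ⊗ S_m ⊆ A ⊗ Ŝ, with
   A_i = {a | σ a = ξ_m^i a}. *)
Definition loopP (xi : nat -> k) (m : nat) (s : A -> A) (x : AS) : Prop :=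
  forall q : rat,
    (forall i : int, q = i%:~R / m%:R -> s x@_q = xi m ^ i *: x@_q) /\
    ((forall i : int, q <> i%:~R / m%:R) -> x@_q = 0).

Definition kiso (P Q : AS -> Prop) (phi : AS -> AS) : Prop :=
  (forall x, P x -> Q (phi x)) /\
  (forall y, Q y -> exists2 x, P x & phi x = y) /\
  (forall x y, P x -> P y -> phi x = phi y -> x = y) /\
  (forall c x y, P x -> P y -> phi (sclS c x + y) = sclS c (phi x) + phi y) /\
  (forall b x, P x -> parS b x -> parS b (phi x)) /\
  (forall x, P x -> phi (derS x) = derS (phi x)) /\
  (forall n x y, P x -> P y -> phi (nprS n x y) = nprS n (phi x) (phi y)).

Definition riso (F : lmodType (laurent k)) (parF : bool -> F -> Prop)
    (derF : F -> F) (nprF : nat -> F -> F -> F)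
    (Q : AS -> Prop) (phi : F -> AS) : Prop :=
  (forall x, Q (phi x)) /\
  (forall y, Q y -> exists x, phi x = y) /\
  injective phi /\
  (forall (r : laurent k) x y, phi (r *: x + y) = rsclS r (phi x) + phi y) /\
  (forall b x, parF b x -> parS b (phi x)) /\
  (forall x, phi (derF x) = derS (phi x)) /\
  (forall n x y, phi (nprF n x y) = nprS n (phi x) (phi y)).

(* F is an Ŝ/R-form of A ⊗_k R:  F ⊗_R Ŝ ≅ (A ⊗_k R) ⊗_R Ŝ = A ⊗_k Ŝ as
   Ŝ-conformal superalgebras.  Such an isomorphism is given by its
   restriction ι = Ψ(- ⊗ 1) : F -> A ⊗ Ŝ (an R-linear even map preserving
   ∂ and the n-products); Ψ is then the Ŝ-linear extension of ι, and
   using the R-basis (t^q)_{0 <= q < 1} of Ŝ (so F ⊗_R Ŝ = ⊕_q F ⊗ t^q),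
   bijectivity of Ψ says: *)
Definition is_form (F : lmodType (laurent k)) (parF : bool -> F -> Prop)
    (derF : F -> F) (nprF : nat -> F -> F -> F) : Prop :=
  exists iota : F -> AS,
    (forall (r : laurent k) x y, iota (r *: x + y) = rsclS r (iota x) + iota y) /\
    (forall b x, parF b x -> parS b (iota x)) /\
    (forall x, iota (derF x) = derS (iota x)) /\
    (forall n x y, iota (nprF n x y) = nprS n (iota x) (iota y)) /\
    (* Ψ surjective *)
    (forall y : AS, exists s : seq (rat * F),
        y = \sum_(p <- s) shS p.1 (iota p.2)) /\
    (* Ψ injective *)
    (forall s : seq (rat * F),
        uniq (map fst s) -> (forall p, p \in s -> (0 <= p.1 < 1)%R) ->
        \sum_(p <- s) shS p.1 (iota p.2) = 0 ->
        forall p, p \in s -> p.2 = 0).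

End N2.

(* Main.v *)
Require Import Defs.
From HB Require Import structures.
From mathcomp Require Import all_boot all_order all_algebra.
From mathcomp Require Import finmap monalg.
From mathcomp Require Import ring zify.
Set Implicit Arguments. Unset Strict Implicit. Unset Printing Implicit Defensive.
Import GRing.Theory Num.Theory Order.TTheory.
Local Open Scope ring_scope.

(** Write Ŝ = k[t^q : q in Q] and let γ be the automorphism t^q -> zeta(q) t^q of Ŝ
    given by the roots of unity. Both a loop algebra L(A,σ) and an Ŝ/R-form are the
    fixed points in A ⊗ Ŝ of a γ-semilinear conformal automorphism τ of locally
    finite order (γσ^-1, resp. id ⊗ γ transported from F ⊗ Ŝ), so it suffices to
    classify such τ up to Ŝ-linear conformal automorphisms.

    If x is even, y is odd and nonzero, x_(0) y = y and x_(n) y = 0 for n > 0, then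
    comparing the terms of top degree in (λ, ∂) in [x_λ y] = y forces x = ±J and
    y in Ŝ G^±. Hence τ J = ±J, and from G^+_(1) G^- = J one gets τ G^+ = r G^±,
    τ G^- = r^-1 G^∓ with r a unit of Ŝ, that is r = c t^q; the image of
    L = G^+_(0) G^- - ∂J/2 is then determined. Conjugating with the gauge
    automorphism G^± -> (b t^s)^±1 G^±, L -> L + s t^-1 J reduces τ to γ or to ωγ: in
    the first case local finiteness gives q = 0 and c a root of unity, in the
    second one extracts a square root of r.

    The same eigenvector statement separates the two loop algebras: an isomorphism
    would send J to ±J, which does not lie in L(A,ω). *)

(** The dichotomy reflects two actions on units of Ŝ. Conjugation by the gauge of a unit u replaces
    r by r u / γ(u) when τ J = J, and by r / (u γ(u)) when τ J = -J. For u = b t^s the quotient u /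
    γ(u) is a mere root of unity, so there local finiteness must first restrict r. The product u
    γ(u) = b^2 ζ(s) t^(2s) is an arbitrary unit because k is algebraically closed, so there every r
    can be removed. The term s t^-1 J in the image of L is forced: (b t^s G^+)_(0) (b^-1 t^-s G^-) =
    L + ∂J/2 + s t^-1 J. All cancellation arguments rest on the order of Q: extremal exponents of
    two factors give a term that nothing can cancel, so Ŝ is a domain and its units are monomials.
    The eigenvector statement involves n-products only. It therefore applies to k-isomorphisms of
    loop algebras, which may fail to be R-linear, as well as to semilinear τ. *)

Section LinearMaps.
Variables (K : fieldType) (U V : lmodType K) (f : U -> V).
Hypothesis fL : linear f.

Lemma lin0 : f 0 = 0.
Proof. by have := fL (-1) 0 0; rewrite scaler0 addr0 scaleN1r addNr. Qed.
Lemma linD x y : f (x + y) = f x + f y.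
Proof. by have := fL 1 x y; rewrite !scale1r. Qed.
Lemma linZ c x : f (c *: x) = c *: f x.
Proof. by have := fL c x 0; rewrite lin0 !addr0. Qed.
Lemma linN x : f (- x) = - f x.
Proof. by rewrite -scaleN1r linZ scaleN1r. Qed.
Lemma linB x y : f (x - y) = f x - f y.
Proof. by rewrite linD linN. Qed.
Lemma lin_sum (I : Type) (r : seq I) (P : pred I) (F : I -> U) :
  f (\sum_(i <- r | P i) F i) = \sum_(i <- r | P i) f (F i).
Proof. exact: (big_morph f linD lin0). Qed.
End LinearMaps.

Lemma scaler_swap (K : fieldType) (V : lmodType K) (a b : K) (x : V) :
  a *: (b *: x) = b *: (a *: x).
Proof. by rewrite !scalerA mulrC. Qed.

(** * The k-space A ⊗ Ŝ, its monomials a ⊗ t^q, the derivation and the shifts by t^p *)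

Section LoopModule.
Variable k : fieldType.
Local Notation A := (A k).
Local Notation AS := (AS k).

HB.instance Definition _ := GRing.Zmodule.on AS.

Definition mon (q : rat) (a : A) : AS := << a *g q >>.

Lemma coef_mon q a r : (mon q a)@_r = a *+ (q == r).
Proof. exact: mcoeffU. Qed.

Lemma ASP (x y : AS) : (forall q, x@_q = y@_q) -> x = y.
Proof. by move=> h; apply/malgP. Qed.

Lemma sclSE_coef c (x : AS) q : (sclS c x)@_q = c *: x@_q.
Proof.
rewrite /sclS raddf_sum /=.
under eq_bigr => p _ do rewrite mcoeffU.
case: msuppP => [qx|qx]; last first.
  rewrite scaler0 big1_seq // => p /andP[_ px]; case: eqP => // e.
  by rewrite -e px in qx.
rewrite (big_fsetD1 q) //= eqxx big1_seq ?addr0 // => p; rewrite !inE.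
by move=> /andP[_ /andP[/negPf ->]].
Qed.

Fact AS_scaleA a b (x : AS) : sclS a (sclS b x) = sclS (a * b) x.
Proof. by apply: ASP => q; rewrite !sclSE_coef scalerA. Qed.
Fact AS_scale1 : left_id 1 (@sclS k).
Proof. by move=> x; apply: ASP => q; rewrite sclSE_coef scale1r. Qed.
Fact AS_scaleDr : right_distributive (@sclS k) +%R.
Proof. by move=> c x y; apply: ASP => q; rewrite !(mcoeffD, sclSE_coef) scalerDr. Qed.
Fact AS_scaleDl (x : AS) : {morph (@sclS k)^~ x : a b / a + b}.
Proof. by move=> a b; apply: ASP => q; rewrite !(mcoeffD, sclSE_coef) scalerDl. Qed.

HB.instance Definition _ :=
  GRing.Zmodule_isLmodule.Build k AS AS_scaleA AS_scale1 AS_scaleDr AS_scaleDl.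

Lemma sclSE c (x : AS) : sclS c x = c *: x. Proof. by []. Qed.

Lemma coef_addS (x y : AS) q : (x + y)@_q = x@_q + y@_q.
Proof. exact: mcoeffD. Qed.
Lemma coef_oppS (x : AS) q : (- x)@_q = - x@_q.
Proof. exact: mcoeffN. Qed.
Lemma coef_zeroS q : (0 : AS)@_q = 0.
Proof. exact: mcoeff0. Qed.
Lemma coef_scaleS c (x : AS) q : (c *: x)@_q = c *: x@_q.
Proof. exact: sclSE_coef. Qed.
Lemma coef_sumS (I : Type) (r : seq I) (P : pred I) (F : I -> AS) q :
  (\sum_(i <- r | P i) F i)@_q = \sum_(i <- r | P i) (F i)@_q.
Proof. exact: (big_morph (mcoeff q) (fun x y => coef_addS x y q) (coef_zeroS q)). Qed.

Lemma mon_linear q : linear (mon q).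
Proof.
move=> c a b; apply: ASP => r; rewrite coef_addS coef_scaleS !coef_mon.
by case: eqP; rewrite ?mulr1n ?mulr0n ?scaler0 ?addr0.
Qed.
HB.instance Definition _ q := GRing.isLinear.Build k A AS *:%R (mon q) (mon_linear q).

Lemma monD q a b : mon q (a + b) = mon q a + mon q b.
Proof. exact: linearD. Qed.
Lemma monZ q c a : mon q (c *: a) = c *: mon q a.
Proof. exact: linearZ. Qed.
Lemma monN q a : mon q (- a) = - mon q a.
Proof. exact: linearN. Qed.
Lemma mon0 q : mon q 0 = 0.
Proof. exact: linear0. Qed.

Lemma AS_sum_mon (x : AS) : x = \sum_(q <- msupp x) mon q x@_q.
Proof. exact: monalgE. Qed.

Lemma AS_ind (P : AS -> Prop) : P 0 -> (forall x y, P x -> P y -> P (x + y)) ->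
  (forall q a, P (mon q a)) -> forall x, P x.
Proof.
by move=> P0 PD Pm x; rewrite (AS_sum_mon x); apply: (big_ind P) => // q _.
Qed.

(** The common shape of all operations on A ⊗ Ŝ: linearity and the value on a monomial are proved
    once, here. *)
Definition mlin (V : lmodType k) (F : rat -> A -> V) (x : AS) : V :=
  \sum_(q <- msupp x) F q x@_q.

Section Mlin.
Variables (V : lmodType k) (F : rat -> A -> V).
Hypothesis FL : forall q, linear (F q).

Lemma mlin_wide (D : {fset rat}) (x : AS) : (msupp x `<=` D)%fset ->
  mlin F x = \sum_(q <- D) F q x@_q.
Proof.
move=> sD; rewrite /mlin (big_fset_incl _ sD) // => q _ /mcoeff_outdom ->.
exact: lin0.
Qed.

Lemma mlin_linear : linear (mlin F).
Proof.
move=> c x y; set D := (msupp (c *: x + y) `|` (msupp x `|` msupp y))%fset.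
rewrite (@mlin_wide D) ?fsubsetUl // (@mlin_wide D x); last first.
  by apply: (fsubset_trans (fsubsetUl _ (msupp y))); rewrite fsubsetUr.
rewrite (@mlin_wide D y); last first.
  by apply: (fsubset_trans (fsubsetUr (msupp x) _)); rewrite fsubsetUr.
rewrite scaler_sumr -big_split /=; apply: eq_bigr => q _.
by rewrite coef_addS coef_scaleS FL.
Qed.

Lemma mlin_mon q a : mlin F (mon q a) = F q a.
Proof.
rewrite (@mlin_wide [fset q]%fset) ?msuppU_le // big_seq_fset1.
by rewrite coef_mon eqxx.
Qed.
End Mlin.

Lemma derA_linear : linear (@derA k).
Proof.
by move=> c a b; apply/ffunP => Z; rewrite !ffunE mulrDr scalerAr.
Qed.
HB.instance Definition _ := GRing.isLinear.Build k A A *:%R (@derA k) derA_linear.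

Lemma derAE (a : A) Z : derA a Z = 'X * a Z. Proof. exact: ffunE. Qed.
Lemma derA0 : derA 0 = 0 :> A. Proof. exact: linear0. Qed.

Fact derS_summand_linear q :
  linear (fun a => mon q (derA a) + mon (q - 1) (ratr q *: a)).
Proof.
move=> c a b; rewrite linearP /= scalerDr scalerA [ratr q * c]mulrC -scalerA.
by rewrite !linearP /= addrACA scalerDr.
Qed.

Lemma derS_linear : linear (@derS k).
Proof. exact: mlin_linear derS_summand_linear. Qed.
HB.instance Definition _ := GRing.isLinear.Build k AS AS *:%R (@derS k) derS_linear.

Lemma derS_mon q a : derS (mon q a) = mon q (derA a) + mon (q - 1) (ratr q *: a).
Proof. exact: (mlin_mon derS_summand_linear). Qed.

Lemma shS_linear p : linear (@shS k p).
Proof.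
apply: (@mlin_linear _ (fun q a => mon (p + q) a)) => q; exact: mon_linear.
Qed.
HB.instance Definition _ p := GRing.isLinear.Build k AS AS *:%R (@shS k p) (shS_linear p).

Lemma shS_mon p q a : shS p (mon q a) = mon (p + q) a.
Proof.
apply: (@mlin_mon _ (fun q a => mon (p + q) a)) => {}q; exact: mon_linear.
Qed.

Lemma derSD x y : derS (x + y) = derS x + derS y :> AS.
Proof. exact: linearD. Qed.
Lemma derSZ c x : derS (c *: x) = c *: derS x :> AS.
Proof. exact: linearZ. Qed.
Lemma shS_add p x y : shS p (x + y) = shS p x + shS p y :> AS.
Proof. exact: linearD. Qed.
Lemma shS_zero p : shS p 0 = 0 :> AS.
Proof. exact: linear0. Qed.
Lemma shSZ p c x : shS p (c *: x) = c *: shS p x :> AS.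
Proof. exact: linearZ. Qed.

Lemma linear_mon_eq (V : lmodType k) (f g : AS -> V) : linear f -> linear g ->
  (forall q a, f (mon q a) = g (mon q a)) -> f =1 g.
Proof.
move=> fL gL fg; apply: AS_ind => [|x y fx fy|//]; first by rewrite !lin0.
by rewrite !linD // fx fy.
Qed.

Lemma shSD p q (x : AS) : shS p (shS q x) = shS (p + q) x.
Proof.
apply: (@linear_mon_eq _ (shS p \o shS q)); try exact: linearP.
by move=> r a /=; rewrite !shS_mon addrA.
Qed.

Lemma shS0 (x : AS) : shS 0 x = x.
Proof.
apply: (@linear_mon_eq _ (shS 0) id) => //; try exact: linearP.
by move=> r a /=; rewrite !shS_mon add0r.
Qed.

Lemma coef_shS p (x : AS) q : (shS p x)@_q = x@_(q - p).
Proof.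
have [xL fL] : linear (fun x : AS => (shS p x)@_q) /\ linear (fun x : AS => x@_(q - p)).
  by split=> c u v; rewrite ?linearP coef_addS coef_scaleS.
apply: (linear_mon_eq xL fL) => r a; rewrite shS_mon !coef_mon.
by rewrite [r == _]eq_sym subr_eq [r + p]addrC eq_sym.
Qed.

End LoopModule.

(* Without this, unification unfolds these sums whenever a match fails. *)
#[local] Opaque mon derS shS derA sclS fgadd fgopp fgzero.

Lemma sum_ord_trunc (V : nmodType) (F : nat -> V) (N M : nat) :
  (forall j, (N <= j)%N -> F j = 0) -> (N <= M)%N ->
  \sum_(j < M) F j = \sum_(j < N) F j.
Proof.
move=> F0 leNM; rewrite -!(big_mkord xpredT) (big_cat_nat _ (n := N)) //=.
by rewrite [X in _ + X]big_nat [X in _ + X]big1 ?addr0 // => j /andP[/F0].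
Qed.

(** Lets two admissible truncation bounds be exchanged without knowing which is larger. *)
Lemma sum_ord_trunc2 (V : nmodType) (F : nat -> V) (N M : nat) :
  (forall j, (N <= j)%N -> F j = 0) -> (forall j, (M <= j)%N -> F j = 0) ->
  \sum_(j < M) F j = \sum_(j < N) F j.
Proof.
move=> FN FM; case: (leqP N M) => [|/ltnW] le; first exact: sum_ord_trunc.
by rewrite [RHS](@sum_ord_trunc _ _ M).
Qed.

(** * The λ-bracket on A: sesquilinearity, degree bounds and brackets of generators *)

Section BracketA.
Variable k : fieldType.
Local Notation A := (A k).
Local Notation AS := (AS k).

Definition iL : 'I_4 := @Ordinal 4 0 isT.
Definition iJ : 'I_4 := @Ordinal 4 1 isT.
Definition iP : 'I_4 := @Ordinal 4 2 isT.
Definition iM : 'I_4 := @Ordinal 4 3 isT.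

Lemma I4_ind (P : 'I_4 -> Prop) : P iL -> P iJ -> P iP -> P iM -> forall X, P X.
Proof.
move=> P0 P1 P2 P3 [[|[|[|[|n]]]] lt] //; by rewrite (bool_irrelevance lt isT).
Qed.

Lemma inord4E : (inord 0 = iL) * (inord 1 = iJ) * (inord 2 = iP) * (inord 3 = iM).
Proof. by do !split; apply: val_inj; rewrite /= inordK. Qed.

Lemma sum_I4 (V : nmodType) (F : 'I_4 -> V) : \sum_X F X = F iL + (F iJ + (F iP + F iM)).
Proof.
rewrite !big_ord_recl big_ord0 addr0.
by congr (_ + (_ + (_ + _))); congr (F _); apply: val_inj.
Qed.

(** Substitution of u for ∂, a ring morphism in p; the bracket uses u = -λ on the left and u = λ + ∂
    on the right. *)
Definition lev (u : {poly {poly k}}) (p : {poly k}) : {poly {poly k}} := (liftP p).[u].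

Lemma liftPE (p : {poly k}) : liftP p = map_poly (polyC \o polyC) p. Proof. by []. Qed.

Lemma levD u : {morph lev u : p q / p + q}.
Proof. by move=> p q; rewrite /lev !liftPE rmorphD hornerD. Qed.
Lemma levM u : {morph lev u : p q / p * q}.
Proof. by move=> p q; rewrite /lev !liftPE rmorphM hornerM. Qed.
Lemma lev0 u : lev u 0 = 0.
Proof. by rewrite /lev !liftPE rmorph0 horner0. Qed.
Lemma lev1 u : lev u 1 = 1.
Proof. by rewrite /lev !liftPE rmorph1 hornerE. Qed.
Lemma levX u : lev u 'X = u.
Proof. by rewrite /lev !liftPE map_polyX hornerX. Qed.
Lemma levC u c : lev u c%:P = cst c.
Proof. by rewrite /lev !liftPE map_polyC hornerC. Qed.
Lemma levZ u c p : lev u (c *: p) = cst c * lev u p.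
Proof. by rewrite -mul_polyC levM levC. Qed.
Lemma levN u p : lev u (- p) = - lev u p.
Proof. by rewrite /lev !liftPE rmorphN hornerN. Qed.

Lemma size_lev (u : {poly {poly k}}) (p : {poly k}) : (size u <= 2)%N -> (size (lev u p) <= size p)%N.
Proof.
move=> su; rewrite /lev liftPE horner_coef.
apply: (leq_trans (size_sum _ _ _)); apply/bigmax_leqP => i _.
rewrite coef_map /= mul_polyC; apply: (leq_trans (size_scale_leq _ _)).
apply: (leq_trans (size_poly_exp_leq _ _)).
have lt_i : (i < size p)%N.
  by apply: leq_trans (ltn_ord i) _; exact: size_poly.
apply: leq_trans lt_i; rewrite ltnS -[leqRHS]mul1n leq_mul2r.
by case: (size u) su => [|[|[|]]] //; rewrite orbT.
Qed.

Lemma size_lam_opp : (size (- lam k)%R <= 2)%N.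
Proof. by rewrite size_polyN size_polyX. Qed.
Lemma size_lam_dd : (size (lam k + dd k)%R <= 2)%N.
Proof. by rewrite /lam /dd size_XaddC. Qed.

Lemma coef_brk X Y Z n : (2 <= n)%N -> (brk k X Y Z)`_n = 0.
Proof.
case: n => [|[|n]] // _.
by elim/I4_ind: X; elim/I4_ind: Y; elim/I4_ind: Z;
 rewrite /brk /= ?coef0 ?coefN ?coef1 ?coefB ?coefD ?coefN /dd /cst /lam
  -?polyCM ?coefCM ?coefC ?coefX //= ?(mulr0, addr0, oppr0).
Qed.

Lemma size_brk X Y Z : (size (brk k X Y Z) <= 2)%N.
Proof. by apply/leq_sizeP => n; exact: coef_brk. Qed.

Lemma lbrAE (a b : A) Z : lbrA a b Z =
  \sum_(X < 4) \sum_(Y < 4) lev (- lam k) (a X) * lev (lam k + dd k) (b Y) * brk k X Y Z.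
Proof. by []. Qed.

Lemma lbrA_linearl c (a a' b : A) Z :
  lbrA (c *: a + a') b Z = cst c * lbrA a b Z + lbrA a' b Z.
Proof.
rewrite !lbrAE mulr_sumr -big_split; apply: eq_bigr => X _ /=.
rewrite mulr_sumr -big_split; apply: eq_bigr => Y _ /=.
by rewrite !ffunE levD levZ; ring.
Qed.

Lemma lbrA_linearr c (a b b' : A) Z :
  lbrA a (c *: b + b') Z = cst c * lbrA a b Z + lbrA a b' Z.
Proof.
rewrite !lbrAE mulr_sumr -big_split; apply: eq_bigr => X _ /=.
rewrite mulr_sumr -big_split; apply: eq_bigr => Y _ /=.
by rewrite !ffunE levD levZ; ring.
Qed.

Lemma coef_cstM c (P : {poly {poly k}}) n : (cst c * P)`_n = c *: P`_n.
Proof. by rewrite /cst coefCM mul_polyC. Qed.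

Lemma nprA_linearl n b : linear (fun a : A => nprA n a b).
Proof.
move=> c a a'; apply/ffunP => Z; rewrite !ffunE lbrA_linearl coefD coef_cstM.
by rewrite scalerDr !scalerA mulrC.
Qed.

Lemma nprA_linearr n a : linear (fun b : A => nprA n a b).
Proof.
move=> c b b'; apply/ffunP => Z; rewrite !ffunE lbrA_linearr coefD coef_cstM.
by rewrite scalerDr !scalerA mulrC.
Qed.

Lemma lbrA_derl (a b : A) Z : lbrA (derA a) b Z = - (lam k * lbrA a b Z).
Proof.
rewrite !lbrAE -mulNr mulr_sumr; apply: eq_bigr => X _ /=.
rewrite mulr_sumr; apply: eq_bigr => Y _ /=.
by rewrite !ffunE levM levX !mulrA.
Qed.

Lemma lbrA_derr (a b : A) Z : lbrA a (derA b) Z = (lam k + dd k) * lbrA a b Z.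
Proof.
rewrite !lbrAE mulr_sumr; apply: eq_bigr => X _ /=.
rewrite mulr_sumr; apply: eq_bigr => Y _ /=.
by rewrite !ffunE levM levX; ring.
Qed.

(** Multiplication by λ shifts coefficients, and n! = n (n-1)! turns the shift into the factor n of
    the conformal axioms; for n = 0 both sides vanish. *)
Lemma coef_lamM (P : {poly {poly k}}) n :
  (n`!)%:R *: (lam k * P)`_n = (n%:R : k) *: (((n.-1)`!)%:R *: P`_n.-1).
Proof.
rewrite /lam mulrC coefMX; case: n => [|n] /=; first by rewrite scaler0 scale0r.
by rewrite scalerA -natrM factS.
Qed.

Lemma nprA_derl n (a b : A) : nprA n (derA a) b = - (n%:R *: nprA n.-1 a b).
Proof.
by apply/ffunP => Z; rewrite !ffunE lbrA_derl coefN scalerN coef_lamM.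
Qed.

Lemma nprA_derr n (a b : A) :
  nprA n a (derA b) = derA (nprA n a b) + n%:R *: nprA n.-1 a b.
Proof.
apply/ffunP => Z; rewrite !ffunE lbrA_derr mulrDl coefD scalerDr coef_lamM addrC.
by congr (_ + _); rewrite /dd coefCM scalerAr.
Qed.

Lemma bndA_size (a : A) X : (size (a X) <= bndA a)%N.
Proof. exact: (leq_bigmax X). Qed.

(** Both substitutions are of degree at most 1 in λ, and so is the bracket of two generators; hence
    the λ-degree is controlled by the ∂-degrees of a and b. *)
Lemma nprA_bound n (a b : A) : (bndA a + bndA b + 2 <= n)%N -> nprA n a b = 0.
Proof.
move=> le_n; apply/ffunP => Z; rewrite !ffunE nth_default ?scaler0 //.
apply: leq_trans le_n; rewrite lbrAE.
apply: (leq_trans (size_sum _ _ _)); apply/bigmax_leqP => X _.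
apply: (leq_trans (size_sum _ _ _)); apply/bigmax_leqP => Y _.
apply: (leq_trans (size_polyMleq _ _)).
have h1 := size_brk X Y Z.
have h2 := size_polyMleq (lev (- lam k) (a X)) (lev (lam k + dd k) (b Y)).
have h3 := size_lev (a X) size_lam_opp.
have h4 := size_lev (b Y) size_lam_dd.
have := bndA_size a X; have := bndA_size b Y; lia.
Qed.

Definition pe (X : 'I_4) (p : {poly k}) : A := [ffun Z => if Z == X then p else 0].
Definition gen X : A := pe X 1.

Lemma nprAE n (a b : A) Z : nprA n a b Z = (n`!)%:R *: (lbrA a b Z)`_n.
Proof. by rewrite ffunE. Qed.

Lemma lbrA_gen X Y Z : lbrA (gen X) (gen Y) Z = brk k X Y Z.
Proof.
rewrite lbrAE (bigD1 X) //= (bigD1 Y) //= !ffunE !eqxx !lev1 !mul1r.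
rewrite big1 ?addr0 => [|W /negPf nW]; last by rewrite ffunE nW lev0 mulr0 mul0r.
rewrite big1 ?addr0 => [//|W /negPf nW]; rewrite big1 // => V _.
by rewrite ffunE nW lev0 !mul0r.
Qed.

Lemma nprA_gen n X Y :
  nprA n (gen X) (gen Y) = [ffun Z => (n`!)%:R *: (brk k X Y Z)`_n].
Proof. by apply/ffunP => Z; rewrite !ffunE lbrA_gen. Qed.

Lemma nprA_gen_ge2 n X Y : (2 <= n)%N -> nprA n (gen X) (gen Y) = 0.
Proof.
by move=> n2; rewrite nprA_gen; apply/ffunP => Z; rewrite !ffunE coef_brk // scaler0.
Qed.

Lemma pe_linear X : linear (pe X).
Proof. by move=> c p q; apply/ffunP => Z; rewrite !ffunE; case: eqP; rewrite ?scaler0 ?addr0. Qed.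
HB.instance Definition _ X := GRing.isLinear.Build k {poly k} A *:%R (pe X) (pe_linear X).

Lemma A_sum_pe (a : A) : a = \sum_X pe X (a X).
Proof.
apply/ffunP => Z; rewrite sum_ffunE (bigD1 Z) //= !ffunE eqxx big1 ?addr0 // => W nW.
by rewrite ffunE eq_sym (negPf nW).
Qed.

Lemma derA_pe X p : derA (pe X p) = pe X ('X * p).
Proof. by apply/ffunP => Z; rewrite !ffunE; case: eqP; rewrite ?mulr0. Qed.

End BracketA.

(** * The embedding of Q into k and binomial coefficients with rational upper entry *)

Section RationalScalars.
Variable k : fieldType.
Hypothesis hk : [pchar k] =i pred0.

Lemma natr0_eq0 n : ((n%:R : k) == 0) = (n == 0)%N.
Proof. by move/pcharf0P: hk => ->. Qed.

Lemma intr0_eq0 (z : int) : ((z%:~R : k) == 0) = (z == 0).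
Proof.
case: z => n; first exact: natr0_eq0.
by rewrite NegzE mulrNz oppr_eq0; exact: natr0_eq0.
Qed.

(** In characteristic 0 any fraction computes [ratr], not only the reduced one. Common denominators
    then show that [ratr] is a ring morphism. *)
Lemma ratr_frac (n d : int) : d != 0 ->
  ratr (n%:~R / d%:~R) = n%:~R / d%:~R :> k.
Proof.
move=> d0; set q := n%:~R / d%:~R : rat; rewrite /ratr.
have dq0 : denq q != 0 by rewrite denq_eq0.
have eq : numq q * d = n * denq q.
  apply: (@intr_inj rat); rewrite !rmorphM /=.
  have := divq_num_den q; rewrite {3}/q => e.
  have d0' : d%:~R != 0 :> rat by rewrite intr_eq0.
  have dq0' : (denq q)%:~R != 0 :> rat by rewrite intr_eq0.
  by move/eqP: e; rewrite eqr_div // => /eqP.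
apply/eqP; rewrite eqr_div ?intr0_eq0 // -!rmorphM /=; by rewrite eq.
Qed.

Lemma rat_common (p q : rat) : exists a b d : int,
  [/\ d != 0, p = a%:~R / d%:~R & q = b%:~R / d%:~R].
Proof.
exists (numq p * denq q), (numq q * denq p), (denq p * denq q).
have hp : (denq p)%:~R != 0 :> rat by rewrite intr_eq0 denq_eq0.
have hq : (denq q)%:~R != 0 :> rat by rewrite intr_eq0 denq_eq0.
split; first by rewrite mulf_neq0 ?denq_eq0.
  by rewrite -{1}[p]divq_num_den !rmorphM /=; field; rewrite ?hp ?hq.
by rewrite -{1}[q]divq_num_den !rmorphM /=; field; rewrite ?hp ?hq.
Qed.

Lemma ratr0D (p q : rat) : ratr (p + q) = ratr p + ratr q :> k.
Proof.
have [a [b [d [d0 -> ->]]]] := rat_common p q.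
by rewrite -mulrDl -rmorphD /= !ratr_frac // -mulrDl -rmorphD.
Qed.

Lemma ratr0M (p q : rat) : ratr (p * q) = ratr p * ratr q :> k.
Proof.
have [a [b [d [d0 -> ->]]]] := rat_common p q.
by rewrite mulf_div -!rmorphM /= !ratr_frac ?mulf_neq0 // mulf_div -!rmorphM.
Qed.

Lemma ratr0_int (z : int) : ratr z%:~R = z%:~R :> k.
Proof. by have := @ratr_frac z 1 isT; rewrite !divr1. Qed.
Lemma ratr0_nat (n : nat) : ratr n%:R = n%:R :> k.
Proof. exact: (ratr0_int n). Qed.
Lemma ratr00 : ratr 0 = 0 :> k. Proof. exact: (ratr0_int 0). Qed.
Lemma ratr01 : ratr 1 = 1 :> k. Proof. exact: (ratr0_int 1). Qed.
Lemma ratr0N p : ratr (- p) = - ratr p :> k.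
Proof. by apply/eqP; rewrite -addr_eq0 -ratr0D addNr ratr00. Qed.

Definition binq (p : rat) (j : nat) : rat := (\prod_(i < j) (p - i%:R)) / (j`!)%:R.

Lemma factq_neq0 j : (j`!)%:R != 0 :> rat.
Proof. by rewrite pnatr_eq0 -lt0n fact_gt0. Qed.

Lemma binqS p j : j.+1%:R * binq p j.+1 = (p - j%:R) * binq p j.
Proof.
rewrite /binq big_ord_recr /= factS natrM.
have h1 : 1 + j%:R != 0 :> rat by rewrite addrC natr1 pnatr_eq0.
by have h2 := factq_neq0 j; field; rewrite h1 h2.
Qed.

Lemma binq0 p : binq p 0 = 1.
Proof. by rewrite /binq big_ord0 divr1. Qed.

Lemma binq_pred p j : p * binq (p - 1) j = j.+1%:R * binq p j.+1.
Proof.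
rewrite /binq big_ord_recl /= factS natrM subr0.
have -> : \prod_(i < j) (p - 1 - i%:R) = \prod_(i < j) (p - (bump 0 i)%:R) :> rat.
  by apply: eq_bigr => i _; rewrite /bump /= natrD opprD addrA.
have h1 : 1 + j%:R != 0 :> rat by rewrite addrC natr1 pnatr_eq0.
by have h2 := factq_neq0 j; field; rewrite h1 h2.
Qed.

Lemma binq_Vandermonde (r p : rat) m :
  binq (r + p) m = \sum_(i < m.+1) binq r i * binq p (m - i).
Proof.
elim: m => [|m IH]; first by rewrite big_ord1 !binq0 mulr1.
have m0 : m.+1%:R != 0 :> rat by rewrite pnatr_eq0.
apply: (mulfI m0); rewrite binqS IH.
(* Write m+1 = i + (m+1-i): the recurrence lowers the first index in one part and the second index
   in the other, and the factors r - i and p - (m-i) add up to r + p - m. *)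
transitivity (\sum_(i < m.+2) (i%:R + (m.+1 - i)%N%:R) * (binq r i * binq p (m.+1 - i))); last first.
  rewrite mulr_sumr; apply: eq_bigr => i _; rewrite -natrD subnKC //.
  by rewrite -ltnS.
under [RHS]eq_bigr => i _ do rewrite mulrDl.
rewrite [RHS]big_split /= [X in _ = X + _]big_ord_recl /= mulr0n mul0r add0r.
rewrite [X in _ = _ + X]big_ord_recr /= subnn mulr0n mul0r addr0.
rewrite -big_split mulr_sumr /=; apply: eq_bigr => i _.
rewrite /bump leq0n !add1n subSS. rewrite [X in _ = X + _]mulrA binqS.
have hi : (i <= m)%N by rewrite -ltnS.
rewrite subSn // [X in _ = _ + X]mulrCA binqS natrB //; ring.
Qed.

Lemma binrE p j : binr k p j = ratr (binq p j). Proof. by []. Qed.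

Lemma binr0 p : binr k p 0 = 1.
Proof. by rewrite binrE binq0 ratr01. Qed.
Lemma binrS p j : j.+1%:R * binr k p j.+1 = ratr (p - j%:R) * binr k p j.
Proof. by rewrite !binrE -ratr0_nat -!ratr0M binqS. Qed.
Lemma binr1 p : binr k p 1 = ratr p.
Proof. by have := binrS p 0; rewrite mul1r binr0 mulr1 subr0. Qed.
Lemma binr_pred p j : ratr p * binr k (p - 1) j = j.+1%:R * binr k p j.+1.
Proof. by rewrite !binrE -ratr0_nat -!ratr0M binq_pred. Qed.
Lemma binr_Vandermonde (r p : rat) m :
  binr k (r + p) m = \sum_(i < m.+1) binr k r i * binr k p (m - i).
Proof.
rewrite binrE binq_Vandermonde (big_morph _ ratr0D ratr00).
by apply: eq_bigr => i _; rewrite ratr0M.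
Qed.
End RationalScalars.

#[local] Opaque nprA binr ratr.

(** * The n-products on A ⊗ Ŝ and the axioms of a conformal superalgebra that they satisfy *)

Section ProductS.
Variable k : fieldType.
Local Notation A := (A k).
Local Notation AS := (AS k).
Implicit Types (n : nat) (p q : rat) (a b : A) (x y : AS).

Definition nprT n p q a b : AS :=
  \sum_(j < bndA a + bndA b + 2) mon (p + q - j%:R) (binr k p j *: nprA (n + j) a b).

Lemma nprSE n x y : nprS n x y = mlin (fun p a => mlin (fun q b => nprT n p q a b) y) x.
Proof. by []. Qed.

(** The bound built into [nprT] varies with a and b, so it is not visibly bilinear; replacing it by
    any valid bound repairs this. *)
Lemma nprT_trunc n p q a b N : (forall j, (N <= j)%N -> nprA (n + j) a b = 0) ->
  nprT n p q a b = \sum_(j < N) mon (p + q - j%:R) (binr k p j *: nprA (n + j) a b).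
Proof.
move=> hN.
apply: (@sum_ord_trunc2 _ (fun j => mon (p + q - j%:R) (binr k p j *: nprA (n + j) a b))) => j le_j.
  by rewrite hN // scaler0 linear0.
by rewrite nprA_bound ?scaler0 ?linear0 //; lia.
Qed.

Lemma nprT_bound n p q a b N : (bndA a + bndA b + 2 <= N)%N ->
  nprT n p q a b = \sum_(j < N) mon (p + q - j%:R) (binr k p j *: nprA (n + j) a b).
Proof. by move=> hN; apply: nprT_trunc => j le_j; rewrite nprA_bound //; lia. Qed.

Lemma nprT_linearl n p q b : linear (fun a => nprT n p q a b).
Proof.
move=> c a a'; pose N := (bndA (c *: a + a')%R + bndA a + bndA a' + bndA b + 2)%N.
rewrite !(@nprT_bound _ _ _ _ _ N); try by rewrite /N; lia.
rewrite scaler_sumr -big_split; apply: eq_bigr => j _ /=.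
by rewrite nprA_linearl scalerDr monD scaler_swap [mon _ (c *: _)]monZ.
Qed.

Lemma nprT_linearr n p q a : linear (fun b => nprT n p q a b).
Proof.
move=> c b b'; pose N := (bndA (c *: b + b')%R + bndA b + bndA b' + bndA a + 2)%N.
rewrite !(@nprT_bound _ _ _ _ _ N); try by rewrite /N; lia.
rewrite scaler_sumr -big_split; apply: eq_bigr => j _ /=.
by rewrite nprA_linearr scalerDr monD scaler_swap [mon _ (c *: _)]monZ.
Qed.

Lemma nprT_mlin_linear n y p : linear (fun a => mlin (fun q b => nprT n p q a b) y).
Proof.
move=> c a a'; rewrite /mlin scaler_sumr -big_split; apply: eq_bigr => q _ /=.
exact: nprT_linearl.
Qed.

Lemma nprS_linearl n y : linear (fun x => nprS n x y).
Proof. exact: (mlin_linear (nprT_mlin_linear n y)). Qed.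

Lemma nprS_linearr n x : linear (nprS n x).
Proof.
move=> c y y'; rewrite !nprSE /mlin scaler_sumr -big_split; apply: eq_bigr => p _.
exact: (mlin_linear (fun q => nprT_linearr n p q _)).
Qed.
HB.instance Definition _ n x := GRing.isLinear.Build k AS AS *:%R (nprS n x) (nprS_linearr n x).

Lemma nprS_mon n p q a b : nprS n (mon p a) (mon q b) = nprT n p q a b.
Proof.
rewrite nprSE mlin_mon; last by move=> r; exact: nprT_mlin_linear.
by rewrite mlin_mon // => r; exact: nprT_linearr.
Qed.

Lemma bilinear_mon_eq (f g : AS -> AS -> AS) :
  (forall y, linear (f^~ y)) -> (forall x, linear (f x)) ->
  (forall y, linear (g^~ y)) -> (forall x, linear (g x)) ->
  (forall p a q b, f (mon p a) (mon q b) = g (mon p a) (mon q b)) -> f =2 g.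
Proof.
move=> fl fr gl gr fg x y; apply: (linear_mon_eq (fl y) (gl y)) => p a.
exact: (linear_mon_eq (fr _) (gr _)).
Qed.

Lemma nprS_bounded x y : exists N, forall n, (N <= n)%N -> nprS n x y = 0.
Proof.
apply: (AS_ind (P := fun x => exists N, forall n, (N <= n)%N -> nprS n x y = 0))=> [|u v [N hN] [M hM]|p a].
- by exists 0 => n _; exact: (lin0 (nprS_linearl n y)).
- exists (N + M)%N => n le_n; rewrite (linD (nprS_linearl n y)) hN ?hM ?addr0 //; lia.
apply: (AS_ind (P := fun y => exists N, forall n, (N <= n)%N -> nprS n (mon p a) y = 0))
  => [|u v [N hN] [M hM]|q b].
- by exists 0 => n _; rewrite linear0.
- exists (N + M)%N => n le_n; rewrite linearD /= hN ?hM ?addr0 //; lia.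
exists (bndA a + bndA b + 2)%N => n le_n; rewrite nprS_mon.
rewrite (@nprT_trunc _ _ _ _ _ 0) ?big_ord0 // => j _.
by apply: nprA_bound; lia.
Qed.

Lemma nprS_shr n p x y : nprS n x (shS p y) = shS p (nprS n x y).
Proof.
move: x y; apply: bilinear_mon_eq => [y|x|y|x|r a q b].
- exact: nprS_linearl.
- by move=> c u v; rewrite shS_linear nprS_linearr.
- by move=> c u v; rewrite nprS_linearl shS_linear.
- by move=> c u v; rewrite nprS_linearr shS_linear.
rewrite shS_mon !nprS_mon /nprT linear_sum; apply: eq_bigr => j _ /=.
by rewrite shS_mon; congr mon; ring.
Qed.

#[local] Opaque nprS.
Hypothesis hk : [pchar k] =i pred0.

Lemma derS_shS p x : derS (shS p x) = shS p (derS x) + ratr p *: shS (p - 1) x.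
Proof.
apply: (linear_mon_eq (f := fun x => derS (shS p x))
  (g := fun x => shS p (derS x) + ratr p *: shS (p - 1) x)).
- by move=> c u v; rewrite shS_linear derS_linear.
- by move=> c u v; rewrite derS_linear !shS_linear !scalerDr addrACA scaler_swap.
move=> q a; rewrite !shS_mon !derS_mon shS_add !shS_mon !monZ (ratr0D hk) scalerDl -addrA.
have -> : p + (q - 1) = p + q - 1 by ring.
have -> : p - 1 + q = p + q - 1 by ring.
by rewrite -[RHS]addrA; congr (_ + _); exact: addrC.
Qed.

(** On monomials, the j-th term gets -(n+j) from ∂ acting on a and, by p binr(p-1, j) = (j+1)
    binr(p, j+1) and a shift of j, the factor +j from δ_t acting on t^p; -n remains. *)
Lemma nprS_derl n x y : nprS n (derS x) y = - (n%:R *: nprS n.-1 x y).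
Proof.
move: x y; apply: bilinear_mon_eq => [y|x|y|x|p a q b].
- by move=> c u v; rewrite derS_linear nprS_linearl.
- exact: nprS_linearr.
- by move=> c u v; rewrite nprS_linearl scalerDr opprD scalerN scaler_swap.
- by move=> c u v; rewrite nprS_linearr scalerDr opprD scalerN scaler_swap.
rewrite derS_mon (linD (nprS_linearl n _)) !nprS_mon (linZ (nprT_linearl n _ _ b)).
set N := (bndA a + bndA b + 2)%N.
have hN m : (N <= m)%N -> nprA m a b = 0 by exact: nprA_bound.
rewrite (@nprT_trunc _ _ _ (derA a) _ N.+1); last first.
  by move=> j lj; rewrite nprA_derl hN ?scaler0 ?oppr0 //; lia.
rewrite (@nprT_trunc _ (p - 1) _ a _ N); last by move=> j lj; rewrite hN //; lia.
rewrite (@nprT_trunc n.-1 p _ a _ N.+1); last by move=> j lj; rewrite hN //; lia.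
pose u j := mon (p + q - j%:R) (binr k p j *: nprA (n + j).-1 a b).
have -> : \sum_(j < N.+1) mon (p + q - j%:R) (binr k p j *: nprA (n + j) (derA a) b)
  = \sum_(j < N.+1) - ((n + j)%:R *: u j).
  apply: eq_bigr => j _; rewrite nprA_derl scalerN monN /u -monZ.
  by rewrite scaler_swap.
have -> : ratr p *: \sum_(j < N) mon (p - 1 + q - j%:R) (binr k (p - 1) j *: nprA (n + j) a b)
  = \sum_(j < N.+1) j%:R *: u j.
  rewrite big_ord_recl scale0r add0r scaler_sumr; apply: eq_bigr => j _.
  rewrite lift0 /u -!monZ !scalerA (binr_pred hk) addnS /=.
  by congr mon; rewrite -natr1; ring.
rewrite -big_split scaler_sumr -sumrN; apply: eq_bigr => j _ /=.
rewrite natrD scalerDl opprD subrK; apply: (congr1 -%R).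
(* At n = 0 the indices (n+j).-1 and n.-1+j differ, but the scalar n is 0. *)
case: n @u => [|n] u; first by rewrite !scale0r.
by rewrite /u addSn.
Qed.

(** The total derivation multiplies t^(p+q-j) by (p-j) + q. The part q comes from differentiating
    t^q; the part p-j, after a shift of j, cancels the j in the factor n+j produced by ∂ on b. *)
Lemma nprS_derr n x y :
  nprS n x (derS y) = derS (nprS n x y) + n%:R *: nprS n.-1 x y.
Proof.
move: x y; apply: bilinear_mon_eq => [y|x|y|x|p a q b].
- exact: nprS_linearl.
- by move=> c u v; rewrite derS_linear nprS_linearr.
- by move=> c u v; rewrite !nprS_linearl derS_linear !scalerDr addrACA scaler_swap.
- by move=> c u v; rewrite !nprS_linearr derS_linear !scalerDr addrACA scaler_swap.
rewrite derS_mon (linD (nprS_linearr n _)) !nprS_mon (linZ (nprT_linearr n _ _ a)).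
set N := (bndA a + bndA b + 2)%N.
have hN m : (N <= m)%N -> nprA m a b = 0 by exact: nprA_bound.
rewrite (@nprT_trunc _ _ _ a (derA b) N.+1); last first.
  by move=> j lj; rewrite nprA_derr !hN ?scaler0 ?derA0 ?addr0 //; lia.
rewrite (@nprT_trunc n p q a _ N); last by move=> j lj; rewrite hN //; lia.
rewrite (@nprT_trunc n p (q - 1) a _ N); last by move=> j lj; rewrite hN //; lia.
rewrite (@nprT_trunc n.-1 p _ a _ N.+1); last by move=> j lj; rewrite hN //; lia.
pose u j := mon (p + q - j%:R) (binr k p j *: nprA (n + j).-1 a b).
pose w j := mon (p + q - j%:R - 1) (binr k p j *: nprA (n + j) a b).
pose d j := mon (p + q - j%:R) (binr k p j *: derA (nprA (n + j) a b)).
have -> : \sum_(j < N.+1) mon (p + q - j%:R) (binr k p j *: nprA (n + j) a (derA b))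
  = \sum_(j < N) d j + \sum_(j < N.+1) (n + j)%:R *: u j.
  have -> : \sum_(j < N) d j = \sum_(j < N.+1) d j.
    by rewrite big_ord_recr /= [d N]/d hN ?leq_addl // derA0 scaler0 mon0 addr0.
  rewrite -big_split; apply: eq_bigr => j _ /=; rewrite nprA_derr scalerDr monD.
  by rewrite /u -monZ scaler_swap.
have -> : ratr q *: \sum_(j < N) mon (p + (q - 1) - j%:R) (binr k p j *: nprA (n + j) a b)
  = \sum_(j < N) ratr q *: w j.
  rewrite scaler_sumr; apply: eq_bigr => j _; congr (_ *: mon _ _); ring.
have -> : derS (\sum_(j < N) mon (p + q - j%:R) (binr k p j *: nprA (n + j) a b))
  = \sum_(j < N) d j + \sum_(j < N) ratr (p + q - j%:R) *: w j.
  rewrite linear_sum -big_split; apply: eq_bigr => j _ /=.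
  by rewrite derS_mon (linZ (@derA_linear k)) /w -monZ.
rewrite -[LHS]addrA -[RHS]addrA; apply: (congr1 (+%R _)).
have -> : \sum_(j < N) ratr (p + q - j%:R) *: w j =
   \sum_(j < N.+1) j%:R *: u j + \sum_(j < N) ratr q *: w j.
  rewrite big_ord_recl scale0r add0r -big_split; apply: eq_bigr => j _.
  have -> : p + q - j%:R = p - j%:R + q by ring.
  rewrite lift0 (ratr0D hk) scalerDl; apply: (congr2 +%R); last by [].
  rewrite /u /w -!monZ !scalerA (binrS hk) addnS /=.
  by congr mon; rewrite -natr1; ring.
rewrite [X in X + _ = _](_ : _ = \sum_(j < N.+1) j%:R *: u j +
   n%:R *: \sum_(j < N.+1) mon (p + q - j%:R) (binr k p j *: nprA (n.-1 + j) a b)).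
  by rewrite -[LHS]addrA -[RHS]addrA; apply: (congr1 (+%R _)); exact: addrC.
rewrite scaler_sumr -big_split; apply: eq_bigr => j _ /=.
rewrite natrD scalerDl [LHS]addrC; apply: (congr1 (+%R _)).
case: n @u @w @d => [|n] u w d; first by rewrite !scale0r.
by rewrite /u addSn.
Qed.

(** The axiom for (ra)_(n) b with r a power of t. On monomials it is the Vandermonde identity for
    binomial coefficients. *)
Lemma nprS_shl n r x y N : (forall m, (N <= m)%N -> nprS m x y = 0) ->
  nprS n (shS r x) y = \sum_(i < N) binr k r i *: shS (r - i%:R) (nprS (n + i) x y).
Proof.
move=> hN.
(* Validity for all large upper bounds is stable under addition in x and in y, which a fixed bound N
   is not. *)
suff [M hM] : exists M, forall M', (M <= M')%N -> nprS n (shS r x) y =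
    \sum_(i < M') binr k r i *: shS (r - i%:R) (nprS (n + i) x y).
  rewrite (hM (M + N)%N) ?leq_addr //.
  apply: (@sum_ord_trunc _ (fun i => binr k r i *: shS (r - i%:R) (nprS (n + i) x y))); last by rewrite leq_addl.
  by move=> j lj; rewrite hN ?shS_zero ?scaler0 //; lia.
clear N hN.
pose Q x y := exists M, forall M', (M <= M')%N -> nprS n (shS r x) y =
    \sum_(i < M') binr k r i *: shS (r - i%:R) (nprS (n + i) x y).
have shl := @nprS_linearl; rewrite -/(Q x y).
move: x; apply: AS_ind => [|u v [M1 h1] [M2 h2]|p a].
- exists 0%N => M _; rewrite shS_zero (lin0 (shl n y)) big1 // => i _.
  by rewrite (lin0 (shl _ y)) shS_zero scaler0.
- exists (M1 + M2)%N => M lM; rewrite shS_add (linD (shl n y)) (h1 M) ?(h2 M); try lia.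
  by rewrite -big_split; apply: eq_bigr => i _; rewrite (linD (shl _ y)) shS_add scalerDr.
move: y; apply: AS_ind => [|u v [M1 h1] [M2 h2]|q b].
- exists 0%N => M _; rewrite (lin0 (nprS_linearr n _)) big1 // => i _.
  by rewrite (lin0 (nprS_linearr _ _)) shS_zero scaler0.
- exists (M1 + M2)%N => M lM; rewrite (linD (nprS_linearr n _)) (h1 M) ?(h2 M); try lia.
  by rewrite -big_split; apply: eq_bigr => i _; rewrite (linD (nprS_linearr _ _)) shS_add scalerDr.
set N := (bndA a + bndA b + 2)%N.
exists N => M lM; rewrite shS_mon nprS_mon (@nprT_bound _ _ _ _ _ M) //.
have hM m : (M <= m)%N -> nprA m a b = 0 by move=> lm; apply: nprA_bound; lia.
pose c m := mon (r + p + q - m%:R) (nprA (n + m) a b).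
pose f i m := (binr k r i * binr k p (m - i)) *: c m.
(* Vandermonde turns the left side into a sum over the triangle i <= m; summing over i first and
   setting m = i + j gives the right side, the terms with i + j >= M being zero. *)
transitivity (\sum_(m < M) \sum_(i < M | (i <= m)%N) f i m).
  apply: eq_bigr => m _; rewrite (binr_Vandermonde hk) scaler_suml (lin_sum (mon_linear _)).
  rewrite (big_ord_widen_cond M (fun _ => true)
    (fun i => mon (r + p + q - m%:R) ((binr k r i * binr k p (m - i)) *: nprA (n + m) a b))) //.
  rewrite /= /f /c; apply: eq_big => [i|i _]; first by rewrite ltnS.
  by rewrite monZ.
rewrite (exchange_big_dep xpredT) //=; apply: eq_bigr => i _.
rewrite nprS_mon (@nprT_bound _ _ _ _ _ M) // (lin_sum (shS_linear _)) scaler_sumr.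
rewrite (big_ord_widen_cond (i + M) _ (fun m => f i m)) ?leq_addl // big_split_ord /=.
rewrite big1 ?add0r => [|m]; last by rewrite leqNgt ltn_ord.
rewrite [LHS]big_mkcond /=; apply: eq_bigr => j _.
rewrite leq_addr /= /f addKn monZ shSZ shS_mon scalerA.
case: ltnP => hj; rewrite /c.
  have -> : r - i%:R + (p + q - j%:R) = r + p + q - (i + j)%:R by rewrite natrD; ring.
  by rewrite addnA.
by rewrite hM ?mon0 ?scaler0 // -addnA; exact: leq_trans hj (leq_addl _ _).
Qed.

End ProductS.

#[local] Opaque nprS.

(** * Products in k[t^Q] as convolutions over exponents: there are no zero divisors *)

Lemma seq_max (s : seq rat) (P : pred rat) : has P s ->
  exists p0, [/\ p0 \in s, P p0 & forall p, p \in s -> P p -> p <= p0].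
Proof.
elim: s => //= a s IH; case: (boolP (has P s)) => [/IH [m [ms Pm mx]] _|/hasPn nP].
  case: (boolP (P a)) => Pa; last first.
    exists m; split=> //; first by rewrite inE ms orbT.
    by move=> p; rewrite inE => /orP[/eqP ->|/mx //]; rewrite (negPf Pa).
  case: (leP a m) => [le|/ltW le].
    exists m; split=> //; first by rewrite inE ms orbT.
    by move=> p; rewrite inE => /orP[/eqP ->|/mx].
  exists a; split; rewrite ?mem_head // => p; rewrite inE => /orP[/eqP ->//|ps Pp].
  exact: le_trans (mx _ ps Pp) le.
rewrite orbF => Pa; exists a; split; rewrite ?mem_head // => p.
by rewrite inE => /orP[/eqP -> //|/nP /negPf ->].
Qed.

(** The coefficient at p0 + q0 is a single product when no other pair of exponents in the supports
    has this sum. *)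
Lemma conv_single (K : fieldType) (P Q : seq rat) (f h : rat -> K) p0 q0 :
  uniq P -> uniq Q -> p0 \in P -> q0 \in Q ->
  (forall p q, p \in P -> q \in Q -> f p != 0 -> h q != 0 ->
     p + q = p0 + q0 -> p = p0) ->
  \sum_(p <- P) \sum_(q <- Q) (f p * h q) *+ (p + q == p0 + q0) = f p0 * h q0.
Proof.
move=> uP uQ p0P q0Q H.
have term p q : p \in P -> q \in Q -> (p != p0) || (q != q0) ->
    (f p * h q) *+ (p + q == p0 + q0) = 0.
  move=> pP qQ pq; have [fp|fp] := eqVneq (f p) 0; first by rewrite fp mul0r mul0rn.
  have [hq|hq] := eqVneq (h q) 0; first by rewrite hq mulr0 mul0rn.
  case: eqP => // e; have e1 := H _ _ pP qQ fp hq e.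
  by move: pq e; rewrite e1 eqxx /= => /eqP nq /addrI.
rewrite (bigD1_seq p0) //= (bigD1_seq q0) //= eqxx mulr1n.
rewrite [X in _ + X + _]big1_seq => [|q /andP[nq qQ]]; last by rewrite term // nq orbT.
rewrite [X in _ + X]big1_seq ?addr0 // => p /andP[np pP].
by rewrite big1_seq // => q /= qQ; rewrite term // np.
Qed.

(** If f h = 0 and h is nonzero then f = 0: otherwise the largest exponents of f and h contribute a
    nonzero coefficient. *)
Lemma conv_eq0 (K : fieldType) (P Q : seq rat) (f h : rat -> K) q1 :
  uniq P -> uniq Q -> q1 \in Q -> h q1 != 0 ->
  (forall r, \sum_(p <- P) \sum_(q <- Q) (f p * h q) *+ (p + q == r) = 0) ->
  forall p, p \in P -> f p = 0.
Proof.
move=> uP uQ q1Q hq1 H p pP; apply/eqP/negPn/negP => fp.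
have [p0 [p0P fp0 mp]] : exists p0, [/\ p0 \in P, f p0 != 0 & forall p, p \in P -> f p != 0 -> p <= p0].
  by apply: (@seq_max P (fun p => f p != 0)); apply/hasP; exists p.
have [q0 [q0Q hq0 mq]] : exists q0, [/\ q0 \in Q, h q0 != 0 & forall q, q \in Q -> h q != 0 -> q <= q0].
  by apply: (@seq_max Q (fun q => h q != 0)); apply/hasP; exists q1.
have := H (p0 + q0); rewrite conv_single // => [/eqP|p' q' p'P q'Q fp' hq' e].
  by rewrite mulf_eq0 (negPf fp0) (negPf hq0).
apply/eqP; rewrite eq_le mp //= -(lerD2r q') e lerD2l; exact: mq.
Qed.

Lemma descend (Q : nat -> Prop) m N : Q N -> (forall n, (m <= n)%N -> Q n.+1 -> Q n) ->
  (m <= N)%N -> Q m.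
Proof.
move=> QN step le; have {QN} : Q (N - m + m)%N by rewrite subnK.
by elim: (N - m)%N => // n IH; rewrite addSn => /(step _ (leq_addl _ _)).
Qed.

(** * Leading symbols of even-odd brackets and the eigenvector statement for J and G^± *)

Section Symbols.
Variable k : fieldType.
Local Notation A := (A k).
Local Notation AS := (AS k).
Implicit Types (n : nat) (a b : A).

(* The coefficients of ∂^0 and ∂^1, as polynomials in λ. *)
Definition dcoef0 (Q : {poly {poly k}}) : {poly k} := map_poly (horner_eval 0) Q.
Definition dcoef1 (Q : {poly {poly k}}) : {poly k} := map_poly (coefp 1) Q.

Lemma coef_dcoef0 Q n : (dcoef0 Q)`_n = (Q`_n)`_0.
Proof. by rewrite coef_map /= horner_evalE horner_coef0. Qed.
Lemma coef_dcoef1 Q n : (dcoef1 Q)`_n = (Q`_n)`_1.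
Proof. by rewrite coef_map. Qed.

Lemma dcoef0M P Q : dcoef0 (P * Q) = dcoef0 P * dcoef0 Q.
Proof. exact: rmorphM. Qed.
Lemma dcoef0D P Q : dcoef0 (P + Q) = dcoef0 P + dcoef0 Q.
Proof. exact: rmorphD. Qed.
Lemma dcoef1D P Q : dcoef1 (P + Q) = dcoef1 P + dcoef1 Q.
Proof. by apply/polyP => i; rewrite !(coefD, coef_dcoef1). Qed.

(** Setting ∂ = 0 is a ring morphism, and the coefficient of ∂ is a derivation over it. *)
Lemma dcoef1M P Q : dcoef1 (P * Q) = dcoef1 P * dcoef0 Q + dcoef0 P * dcoef1 Q.
Proof.
apply/polyP => n; rewrite coefD !coefM coef_dcoef1 coefM coef_sum -big_split /=.
apply: eq_bigr => i _; rewrite !(coef_dcoef0, coef_dcoef1) coefM !big_ord_recl big_ord0 /=.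
by rewrite addr0 addrC.
Qed.

Lemma dcoef0_lam : dcoef0 (lam k) = 'X.
Proof. exact: map_polyX. Qed.
Lemma dcoef0_dd : dcoef0 (dd k) = 0.
Proof. by rewrite /dcoef0 /dd map_polyC /= horner_evalE hornerX polyC0. Qed.
Lemma dcoef0_cst c : dcoef0 (cst c) = c%:P.
Proof. by rewrite /dcoef0 /cst map_polyC /= horner_evalE hornerC. Qed.
Lemma dcoef1_lam : dcoef1 (lam k) = 0.
Proof. by apply/polyP => i; rewrite coef_dcoef1 coefX coef0; case: eqP; rewrite ?coef1 ?coef0. Qed.
Lemma dcoef1_dd : dcoef1 (dd k) = 1.
Proof.
by apply/polyP => i; rewrite coef_dcoef1 /dd coefC coef1; case: eqP; rewrite ?coefX ?coef0.
Qed.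
Lemma dcoef1_cst c : dcoef1 (cst c) = 0.
Proof.
by apply/polyP => i; rewrite coef_dcoef1 /cst coefC coef0; case: eqP; rewrite ?coefC ?coef0.
Qed.
Lemma dcoef0N P : dcoef0 (- P) = - dcoef0 P.
Proof. exact: rmorphN. Qed.
Lemma dcoef1N P : dcoef1 (- P) = - dcoef1 P.
Proof. by apply/polyP => i; rewrite !(coefN, coef_dcoef1). Qed.

Lemma dcoef0_lev u p : dcoef0 (lev u p) = p \Po dcoef0 u.
Proof.
elim/poly_ind: p => [|p c IH]; first by rewrite lev0 comp_poly0 /dcoef0 rmorph0.
rewrite levD levM levX levC dcoef0D dcoef0M IH dcoef0_cst.
by rewrite comp_polyD comp_polyM comp_polyX comp_polyC.
Qed.

Lemma dcoef1_lev u p : dcoef1 (lev u p) = (p^`() \Po dcoef0 u) * dcoef1 u.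
Proof.
elim/poly_ind: p => [|p c IH].
  by rewrite lev0 deriv0 comp_poly0 mul0r; apply/polyP => i; rewrite coef_dcoef1 !coef0.
rewrite levD levM levX levC dcoef1D dcoef1M IH dcoef1_cst dcoef0_lev addr0.
rewrite derivD derivM derivX derivC addr0 mulr1 comp_polyD comp_polyM comp_polyX; ring.
Qed.

Definition flip (p : {poly k}) : {poly k} := p \Po (- 'X).

Lemma coef_flip p n : (flip p)`_n = (-1) ^+ n * p`_n.
Proof.
rewrite /flip; elim/poly_ind: p n => [|p c IH] n; first by rewrite comp_poly0 !coef0 mulr0.
rewrite comp_polyD comp_polyM comp_polyX comp_polyC mulrN coefD coefN !coefMX !coefD !coefMX !coefC.
case: n => [|n] /=; first by rewrite expr0 mul1r oppr0.
by rewrite !addr0 IH exprS mulN1r mulNr.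
Qed.

(** The J-charge of G^+ and G^-; the value on L and J is arbitrary. *)
Definition sgnZ (Z : 'I_4) : k := if Z == iP then 1 else -1.

(* The symbol of [a_λ -] at ∂ = 0 on the odd line Z. *)
Definition Wsym (Z : 'I_4) (a : A) : {poly k} :=
  flip (a iL) * (thalf k)%:P * 'X + (sgnZ Z)%:P * flip (a iJ).

Definition is_odd_idx (Z : 'I_4) := (Z == iP) || (Z == iM).

(** Even elements act diagonally on the two odd lines: only the coordinate [b Z] enters. The
    eigenvector problem thereby becomes one about products of polynomials. *)
Lemma lbrA_even_odd a b Z : is_odd_idx Z -> parA false a -> parA true b ->
  lbrA a b Z = (lev (- lam k) (a iL) * (dd k + cst (thalf k) * lam k)
    + lev (- lam k) (a iJ) * cst (sgnZ Z)) * lev (lam k + dd k) (b Z).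
Proof.
move=> oZ ea ob.
have a2 : a iP = 0 by apply: ea. have a3 : a iM = 0 by apply: ea.
have b0 : b iL = 0 by apply: ob. have b1 : b iJ = 0 by apply: ob.
rewrite lbrAE !sum_I4 a2 a3 b0 b1 !lev0.
case/orP: oZ => /eqP ->; rewrite /brk /sgnZ /= /cst ?polyCN ?polyC1; ring.
Qed.

Lemma nprA_coef0 n a b Z : is_odd_idx Z -> parA false a -> parA true b ->
  (nprA n a b Z)`_0 = (n`!)%:R * (Wsym Z a * b Z)`_n.
Proof.
move=> oZ ea ob; rewrite nprAE coefZ -coef_dcoef0 (lbrA_even_odd oZ ea ob).
rewrite dcoef0M dcoef0D !dcoef0M !dcoef0D !dcoef0_lev !dcoef0D dcoef0N !dcoef0M !dcoef0_cst.
rewrite dcoef0_lam dcoef0_dd addr0 comp_polyXr add0r /Wsym /flip.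
by apply: (congr1 (fun P : {poly k} => (n`!)%:R * P`_n)); ring.
Qed.

Lemma nprA_coef1 n a b Z : is_odd_idx Z -> parA false a -> parA true b ->
  (nprA n a b Z)`_1 = (n`!)%:R * (flip (a iL) * b Z + Wsym Z a * (b Z)^`())`_n.
Proof.
move=> oZ ea ob; rewrite nprAE coefZ -coef_dcoef1 (lbrA_even_odd oZ ea ob).
rewrite dcoef1M dcoef0D !dcoef1D !dcoef1M !dcoef0M !dcoef0D !dcoef1D !dcoef1M !dcoef0_lev !dcoef1_lev.
rewrite !dcoef1D !dcoef0D dcoef0N !dcoef0M !dcoef0_cst !dcoef1_cst dcoef1N dcoef1_lam.
rewrite dcoef0_lam dcoef0_dd dcoef1_dd addr0 !comp_polyXr add0r /Wsym /flip.
by apply: (congr1 (fun P : {poly k} => (n`!)%:R * P`_n)); ring.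
Qed.

Lemma size_mul_le (p q : {poly k}) m n : (size p <= m.+1)%N -> (size q <= n.+1)%N ->
  (size (p * q)%R <= (m + n).+1)%N.
Proof.
move=> sp sq; apply: leq_trans (size_polyMleq _ _) _.
move: (size p) (size q) sp sq => a b; lia.
Qed.

Lemma coef_top_mul (p q : {poly k}) m n : (size p <= m.+1)%N -> (size q <= n.+1)%N ->
  (p * q)`_(m + n) = p`_m * q`_n.
Proof.
move=> sp sq; rewrite coefM (bigD1 (inord m)) //= inordK ?ltnS ?leq_addr // addKn.
rewrite big1 ?addr0 // => i ni; case: (ltngtP i m) => [lt|gt|e].
- by rewrite [q`__]nth_default ?mulr0 //; apply: leq_trans sq _; lia.
- by rewrite nth_default ?mul0r //; apply: leq_trans sp _.
by case/eqP: ni; apply: val_inj; rewrite /= inordK ?ltnS ?leq_addr.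
Qed.

Hypothesis hk : [pchar k] =i pred0.

(** Derivatives of t^p occur only in the terms j > 0. Where these do not reach the coefficient, the
    product is a plain convolution, to which [conv_eq0] applies. *)
Lemma coef_nprS_top n (x y : AS) Z e r :
  (forall p q j, (0 < j)%N -> (nprA (n + j) x@_p y@_q Z)`_e = 0) ->
  ((nprS n x y)@_r Z)`_e =
    \sum_(p <- msupp x) \sum_(q <- msupp y) (nprA n x@_p y@_q Z)`_e *+ (p + q == r).
Proof.
move=> H; rewrite nprSE /mlin coef_sumS sum_ffunE coef_sum; apply: eq_bigr => p _.
rewrite coef_sumS sum_ffunE coef_sum; apply: eq_bigr => q _.
rewrite /nprT coef_sumS sum_ffunE coef_sum.
have -> : (bndA x@_p + bndA y@_q + 2)%N = (bndA x@_p + bndA y@_q + 1).+1 by lia.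
rewrite big_ord_recl /= subr0 big1 ?addr0 => [|j _].
  rewrite coef_mon addn0; case: eqP => _; last by rewrite mulr0n ffunE coef0.
  by rewrite !mulr1n ffunE coefZ (binr0 hk) mul1r.
rewrite coef_mon; case: eqP => _; last by rewrite mulr0n ffunE coef0.
by rewrite mulr1n ffunE coefZ H ?mulr0.
Qed.

Lemma size_bounded (x : AS) : exists n, forall q Z, (size (x@_q Z) <= n)%N.
Proof.
exists (\max_(q <- msupp x) bndA x@_q)%N => q Z.
case: (boolP (q \in msupp x)) => [qx|/mcoeff_outdom ->]; last by rewrite ffunE size_poly0.
by apply: leq_trans (bndA_size _ _) _; exact: (leq_bigmax_seq _ qx).
Qed.

Lemma top_degree (y : AS) : y <> 0 -> exists j Z q,
  (y@_q Z)`_j != 0 /\ forall q Z, (size (y@_q Z) <= j.+1)%N.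
Proof.
move=> y0.
pose P n := all (fun q => [forall Z, size (y@_q Z) <= n]%N) (msupp y).
have PP n : reflect (forall q Z, (size (y@_q Z) <= n)%N) (P n).
  apply: (iffP allP) => [H q Z|H q _]; last by apply/forallP => Z.
  case: (boolP (q \in msupp y)) => [/H /forallP //|/mcoeff_outdom ->].
  by rewrite ffunE size_poly0.
have exP : exists n, P n by have [n hn] := size_bounded y; exists n; apply/PP.
case: (ex_minnP exP) => [[|j] /PP Pj minj].
  case: y0; apply: ASP => q; apply/ffunP => Z; rewrite coef_zeroS ffunE.
  by apply/eqP; rewrite -size_poly_leq0.
exists j; have /negP nP : ~ P j by move/minj; rewrite ltnn.
have /allPn [q qy /forallPn [Z nZ]] := nP.
exists Z, q; split=> //.
have sz : size (y@_q Z) = j.+1 by apply/eqP; rewrite eqn_leq Pj ltnNge.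
by rewrite -[j]/(j.+1.-1) -sz -/(lead_coef _) lead_coef_eq0 -size_poly_gt0 sz.
Qed.

Section Eigenpair.
Variables (x y : AS).
Hypotheses (ex : parS false x) (oy : parS true y) (y0 : y <> 0).
Hypothesis xy0 : nprS 0 x y = y.
Hypothesis xyS : forall n, nprS n.+1 x y = 0.

(** Let [j] be the ∂-degree of y, attained on the line [Z]. The vanishing of x_(n) y for n > 0 makes
    the symbol [Wsym Z] of x constant, and zero if j > 0. The coefficient of ∂ then kills the L-part
    of x. Now j > 0 would give x = 0, hence y = x_(0) y = 0. *)
Lemma eigenpair_shape : exists Z q, [/\ is_odd_idx Z, (y@_q Z)`_0 != 0,
  forall q Z, (size (y@_q Z) <= 1)%N & forall p, x@_p iL = 0 /\ (size (x@_p iJ) <= 1)%N].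
Proof.
have [j [Z [q [hq sy]]]] := top_degree y0.
have oZ : is_odd_idx Z.
  have yLJ : (y@_q iL = 0) * (y@_q iJ = 0) by split; exact: oy.
  by move: hq; elim/I4_ind: Z => //; rewrite yLJ coef0 eqxx.
have qy : q \in msupp y.
  by rewrite -mcoeff_neq0; apply: contraNneq hq => ->; rewrite ffunE coef0.
have ux := fset_uniq (msupp x); have uy := fset_uniq (msupp y).
have fact0 n : (n`!)%:R != 0 :> k by rewrite natr0_eq0 // -lt0n fact_gt0.
have W0 : Wsym Z 0 = 0.
  by rewrite /Wsym /flip !ffunE !comp_poly0 !mul0r mulr0 addr0.
(* The coefficient of λ^(w+j) at ∂ = 0 is the product in Ŝ of the two leading coefficients; it
   vanishes because w + j > 0, and that of y is nonzero, so the degree bound on the symbol drops by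
   one. *)
have stepW w : (0 < w + j)%N -> (forall p, size (Wsym Z x@_p) <= w.+1)%N ->
    (forall p, size (Wsym Z x@_p) <= w)%N.
  move=> wj H; pose f p := (Wsym Z x@_p)`_w; pose h q := (y@_q Z)`_j.
  have fx : forall p, p \in msupp x -> f p = 0.
    apply: (conv_eq0 (h := h) ux uy qy hq) => r.
    have zero : ((nprS (w + j) x y)@_r Z)`_0 = 0.
      by case: (w + j)%N wj => // n _; rewrite xyS coef_zeroS ffunE coef0.
    apply: (mulfI (fact0 (w + j)%N)); rewrite mulr0 -[RHS]zero coef_nprS_top.
      rewrite mulr_sumr; apply: eq_bigr => p _; rewrite mulr_sumr; apply: eq_bigr => q' _.
      by rewrite nprA_coef0 // (coef_top_mul (H p) (sy q' Z)) mulrnAr.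
    move=> p q' i i0; rewrite nprA_coef0 // nth_default ?mulr0 //.
    apply: leq_trans (size_mul_le (H p) (sy q' Z)) _; rewrite -addn1 leq_add2l.
    exact: i0.
  move=> p; apply/leq_sizeP => i; rewrite leq_eqVlt => /orP[/eqP <-|lt].
    case: (boolP (p \in msupp x)) => [/fx //|/mcoeff_outdom ->]; by rewrite W0 coef0.
  by rewrite nth_default // (leq_trans (H p)).
have [N hN] : exists N, forall p, (size (Wsym Z x@_p) <= N)%N.
  exists (\max_(p <- msupp x) size (Wsym Z x@_p))%N => p.
  case: (boolP (p \in msupp x)) => [px|/mcoeff_outdom ->]; last by rewrite W0 size_poly0.
  exact: (leq_bigmax_seq _ px).
(* The factor [(0 < j)%:R] encodes that the symbol is zero as soon as j > 0. *)
have Wj : forall p, Wsym Z x@_p * (0 < j)%:R = 0 /\ (size (Wsym Z x@_p) <= 1)%N.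
  move=> p; have W1 : (size (Wsym Z x@_p) <= 1)%N.
    move: p; apply: (@descend (fun n => forall p, (size (Wsym Z x@_p) <= n)%N) 1 N.+1) => //.
      by move=> p; exact: leqW.
    by move=> n n1; apply: stepW; rewrite addn_gt0 n1.
  split=> //; case: (posnP j) => [_|j0]; rewrite ?mulr0 // mulr1.
  apply/eqP; rewrite -size_poly_leq0; move: p {W1}.
  apply: (@descend (fun n => forall p, (size (Wsym Z x@_p) <= n)%N) 0 N) => //.
  by move=> n _; apply: stepW; rewrite addn_gt0 j0 orbT.
(* Either the symbol vanishes, or j = 0 and y is constant in ∂; the derivative term of [nprA_coef1]
   therefore drops out. *)
have Wd p q' : Wsym Z x@_p * (y@_q' Z)^`() = 0.
  case: (posnP j) => j0; last first.
    by have [] := Wj p; rewrite j0 mulr1 => ->; rewrite mul0r.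
  have /size1_polyC -> : (size (y@_q' Z) <= 1)%N by have := sy q' Z; rewrite j0.
  by rewrite derivC mulr0.
(* The same descent on the coefficient of ∂. For e + j > 0 the product is zero; for e + j = 0 it is
   y itself, which has no ∂-term since j = 0. *)
have stepL e : (forall p, size (x@_p iL) <= e.+1)%N -> (forall p, size (x@_p iL) <= e)%N.
  move=> H; have H' p : (size (flip (x@_p iL)) <= e.+1)%N.
    by apply/leq_sizeP => i le; rewrite coef_flip nth_default ?mulr0 // (leq_trans (H p)).
  pose f p := (flip (x@_p iL))`_e; pose h q := (y@_q Z)`_j.
  have fx : forall p, p \in msupp x -> f p = 0.
    apply: (conv_eq0 (h := h) ux uy qy hq) => r.
    have zero : ((nprS (e + j) x y)@_r Z)`_1 = 0.
      case ej: (e + j)%N => [|n]; last by rewrite xyS coef_zeroS ffunE coef0.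
      rewrite xy0 nth_default //; apply: leq_trans (sy _ _) _; lia.
    apply: (mulfI (fact0 (e + j)%N)); rewrite mulr0 -[RHS]zero coef_nprS_top.
      rewrite mulr_sumr; apply: eq_bigr => p _; rewrite mulr_sumr; apply: eq_bigr => q' _.
      by rewrite nprA_coef1 // Wd addr0 (coef_top_mul (H' p) (sy q' Z)) mulrnAr.
    move=> p q' i i0; rewrite nprA_coef1 // Wd addr0 nth_default ?mulr0 //.
    apply: leq_trans (size_mul_le (H' p) (sy q' Z)) _; rewrite -addn1 leq_add2l.
    exact: i0.
  move=> p; apply/leq_sizeP => i; rewrite leq_eqVlt => /orP[/eqP <-|lt].
    case: (boolP (p \in msupp x)) => [/fx|/mcoeff_outdom ->]; last by rewrite ffunE coef0.
    by rewrite /f coef_flip => /eqP; rewrite mulf_eq0 signr_eq0 => /eqP.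
  by rewrite nth_default // (leq_trans (H p)).
have xL p : x@_p iL = 0.
  apply/eqP; rewrite -size_poly_leq0; move: p.
  have [M hM] := size_bounded x.
  by apply: (@descend (fun n => forall p, (size (x@_p iL) <= n)%N) 0 M) => // n _; apply: stepL.
have WJ p : Wsym Z x@_p = (sgnZ Z)%:P * flip (x@_p iJ).
  by rewrite /Wsym xL {1}/flip comp_poly0 !mul0r add0r.
have sg0 : sgnZ Z != 0 by rewrite /sgnZ; case: ifP => _; rewrite ?oppr_eq0 oner_eq0.
have xJ p n : (Wsym Z x@_p)`_n = 0 -> (x@_p iJ)`_n = 0.
  rewrite WJ coefCM coef_flip => /eqP.
  by rewrite !mulf_eq0 (negPf sg0) signr_eq0 => /eqP.
have j0 : j = 0%N.
  case: (posnP j) => // j0; case: y0; rewrite -xy0.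
  have -> : x = 0.
    apply: ASP => p; rewrite coef_zeroS; apply/ffunP; elim/I4_ind; rewrite ffunE.
    - exact: xL.
    - apply/polyP => n; rewrite coef0 xJ //.
      by have [] := Wj p; rewrite j0 mulr1 => -> _; rewrite coef0.
    - exact: ex.
    exact: ex.
  exact: (lin0 (nprS_linearl 0 y)).
exists Z, q; rewrite j0 in hq sy; split=> // p; split=> //.
apply/leq_sizeP => n n1; apply: xJ; rewrite nth_default //.
by apply: leq_trans n1; have [] := Wj p.
Qed.

(** With x = g J and y = h_+ G^+ + h_- G^- over Ŝ, the equation x_(0) y = y reads ± g h_± = h_±. As
    Ŝ is a domain, g = ±1 on a line where h is nonzero, and then h = -h on the other line. *)
Lemma eigenpair :
  (x = mon 0 (gen k iJ) /\ forall q, exists c, y@_q = c *: gen k iP) \/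
  (x = mon 0 (- gen k iJ) /\ forall q, exists c, y@_q = c *: gen k iM).
Proof.
have [Z [q1 [oZ hq1 sy sx]]] := eigenpair_shape.
pose g p := (x@_p iJ)`_0; pose h Z q := (y@_q Z)`_0.
have eqn Z' r : is_odd_idx Z' ->
  \sum_(p <- msupp x) \sum_(q <- msupp y) (sgnZ Z' * g p * h Z' q) *+ (p + q == r) = h Z' r.
  have prodE p q : Wsym Z' x@_p * y@_q Z' = (sgnZ Z' * g p * h Z' q)%:P.
    rewrite /Wsym (sx p).1 {1}/flip comp_poly0 !mul0r add0r.
    rewrite (size1_polyC (sx p).2) /flip comp_polyC (size1_polyC (sy q Z')).
    by rewrite -!polyCM.
  move=> oZ'; rewrite /h -[in RHS]xy0 coef_nprS_top.
    apply: eq_bigr => p _; apply: eq_bigr => q _.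
    by rewrite nprA_coef0 // prodE coefC /= mul1r.
  by move=> p q [|i] // _; rewrite nprA_coef0 // prodE coefC /= mulr0.
have ux := fset_uniq (msupp x); have uy := fset_uniq (msupp y).
(* Cancel h in (± g - 1) h = 0. The exponent 0 is added to the support to make room for the constant
   1. *)
have gE p : sgnZ Z * g p = (p == 0)%:R.
  pose P := (0 |` msupp x)%fset; have uP := fset_uniq P.
  apply/eqP; rewrite -subr_eq0.
  case: (boolP (p \in P)) => [pP|]; last first.
    rewrite !inE negb_or => /andP[/negPf -> /mcoeff_outdom px].
    by rewrite /g px ffunE coef0 mulr0 subr0.
  have qy : q1 \in msupp y.
    by rewrite -mcoeff_neq0; apply: contraNneq hq1 => ->; rewrite ffunE coef0.
  apply/eqP; apply: (conv_eq0 (f := fun p => sgnZ Z * g p - (p == 0)%:R) (h := h Z) uP uy qy hq1) => // r.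
  under eq_bigr => p' _ do (under eq_bigr => q _ do rewrite mulrBl mulrnBl; rewrite sumrB).
  rewrite sumrB; apply/eqP; rewrite subr_eq0; apply/eqP.
  transitivity (h Z r).
    rewrite -(eqn Z r oZ); symmetry; apply: big_fset_incl; first exact: fsubsetU1.
    move=> p' _ /mcoeff_outdom px; rewrite big1 // => q _.
    by rewrite /g px ffunE coef0 mulr0 mul0r mul0rn.
  rewrite (bigD1_seq 0) ?fset1U1 //= ?eqxx [X in _ + X]big1 ?addr0 => [|p' /negPf np].
    rewrite [RHS](_ : _ = \sum_(q <- msupp y) h Z q *+ (q == r)); last first.
      by apply: eq_bigr => q _; rewrite mul1r add0r.
    case: (boolP (r \in msupp y)) => [ry|/[dup] nry /mcoeff_outdom ry].
      rewrite (bigD1_seq r) //= eqxx big1 ?addr0 // => q /negPf ->; exact: mulr0n.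
    rewrite /h ry ffunE coef0 big1_seq // => q /andP[_ qy'].
    by case: eqP => // e; rewrite -e qy' in nry.
  by rewrite big1 // => q _; rewrite np mul0r mul0rn.
have sgK : sgnZ Z * sgnZ Z = 1 :> k by rewrite /sgnZ; case: ifP; rewrite ?mulrNN mulr1.
have xE : x = mon 0 (sgnZ Z *: gen k iJ).
  apply: ASP => p; rewrite coef_mon; apply/ffunP; elim/I4_ind.
  - rewrite (sx p).1; case: eqP; rewrite ?mulr1n ?mulr0n !ffunE //= ?scaler0 //.
  - have -> : x@_p iJ = (sgnZ Z * (p == 0)%:R)%:P.
      by rewrite -gE mulrA sgK mul1r; exact: size1_polyC (sx p).2.
    rewrite eq_sym; case: eqP; rewrite ?mulr1n ?mulr0n !ffunE //= ?mulr0 ?mulr1 //.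
    by rewrite -mul_polyC mulr1.
  - by rewrite ex //; case: eqP; rewrite ?mulr1n ?mulr0n !ffunE //= ?scaler0.
  by rewrite ex //; case: eqP; rewrite ?mulr1n ?mulr0n !ffunE //= ?scaler0.
(* The opposite charge turns the eigenvalue into -1, so the coordinate equals its own negative and
   vanishes in characteristic 0. *)
have other Z' q : is_odd_idx Z' -> Z' != Z -> y@_q Z' = 0.
  move=> oZ' nZ; rewrite (size1_polyC (sy q Z')) -/(h Z' q).
  have sgN : sgnZ Z' = - sgnZ Z :> k.
    by move: nZ; case/orP: oZ' => /eqP ->; case/orP: oZ => /eqP ->; rewrite /sgnZ /= ?opprK.
  have := eqn Z' q oZ'; under eq_bigr => p _ do
    (under eq_bigr => q' _ do rewrite sgN mulNr gE mulNr mulNrn; rewrite sumrN).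
  rewrite sumrN => e.
  suff e2 : h Z' q = - h Z' q.
    have : 2%:R * h Z' q = 0 by rewrite mulr_natl mulr2n {1}e2 addNr.
    by move/eqP; rewrite mulf_eq0 natr0_eq0 //= => /eqP ->.
  rewrite -{1}e; congr (- _).
  rewrite xE.
  case: (boolP (0 \in msupp x)) => x0; last first.
    have := gE 0; rewrite /g (mcoeff_outdom x0) ffunE coef0 mulr0 eqxx => /eqP.
    by rewrite eq_sym oner_eq0.
  rewrite -xE (bigD1_seq 0) //= ?eqxx [X in _ + X]big1 ?addr0 => [|p' /negPf np].
    under eq_bigr => q' _ do rewrite mul1r add0r.
    case: (boolP (q \in msupp y)) => [ry|/[dup] nry /mcoeff_outdom ry].
      rewrite (bigD1_seq q) //= eqxx big1 ?addr0 // => q' /negPf ->; exact: mulr0n.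
    rewrite /h ry ffunE coef0 big1_seq // => q' /andP[_ qy'].
    by case: eqP => // e'; rewrite -e' qy' in nry.
  by rewrite big1 // => q' _; rewrite np mul0r mul0rn.
have yE q : y@_q = h Z q *: gen k Z.
  apply/ffunP => Z'; rewrite !ffunE; case: eqP => [->|/eqP nZ]; last first.
    rewrite scaler0; case: (boolP (is_odd_idx Z')) => [oZ'|eZ]; first exact: other.
    by apply: oy; move: eZ; elim/I4_ind: Z' nZ.
  by rewrite (size1_polyC (sy q Z)) -mul_polyC mulr1.
case/orP: (oZ) => /eqP eZ; [left|right]; rewrite eZ in yE xE; split.
- by rewrite xE /sgnZ /= scale1r.
- by move=> q; exists (h iP q).
- by rewrite xE /sgnZ /= scaleN1r.
by move=> q; exists (h iM q).
Qed.
End Eigenpair.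

End Symbols.

(** * Semilinear maps commuting with the derivation: uniqueness and extension from the four
    generators *)

Section FreeModule.
Variable k : fieldType.
Local Notation A := (A k).
Local Notation AS := (AS k).
Implicit Types (n : nat) (q : rat) (a : A) (x y : AS).

Lemma mon_derA q a : mon q (derA a) = derS (mon q a) + (- ratr q) *: mon (q - 1) a.
Proof. by rewrite derS_mon monZ scaleNr addrK. Qed.

(** By the Leibniz rule, ∂a ⊗ t^q is the total derivative of a ⊗ t^q minus q a ⊗ t^(q-1), so powers
    of ∂ are reached by induction. *)
Lemma AS_span (P : AS -> Prop) :
  (forall x y, P x -> P y -> P (x + y)) -> (forall c x, P x -> P (c *: x)) ->
  (forall x, P x -> P (derS x)) -> (forall q X, P (mon q (gen k X))) -> forall x, P x.
Proof.
move=> PD PZ Pd Pg; have P0 : P 0.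
  by rewrite -[0](scale0r (mon 0 (gen k iL))); exact: PZ.
have Pi i : forall q X, P (mon q (pe X 'X^i)).
  elim: i => [|i IH] q X; first by rewrite expr0; exact: Pg.
  by rewrite exprS -derA_pe mon_derA; apply: PD; [exact/Pd|exact/PZ].
apply: AS_ind => // q a; rewrite (A_sum_pe a) (lin_sum (mon_linear q)).
apply: (big_ind P) => // X _; rewrite -[a X]coefK poly_def.
rewrite (lin_sum (@pe_linear _ X)) (lin_sum (mon_linear q)); apply: (big_ind P) => // i _.
by rewrite (linZ (@pe_linear _ X)) monZ; exact/PZ.
Qed.

(** The weight z covers Ŝ-linear maps (z = 1) and γ-semilinear ones at once. *)
Lemma linear_span_eq (z : rat -> k) (f g : AS -> AS) : linear f -> linear g ->
  (forall x, f (derS x) = derS (f x)) -> (forall x, g (derS x) = derS (g x)) ->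
  (forall q x, f (shS q x) = z q *: shS q (f x)) ->
  (forall q x, g (shS q x) = z q *: shS q (g x)) ->
  (forall X, f (mon 0 (gen k X)) = g (mon 0 (gen k X))) -> f =1 g.
Proof.
move=> fL gL fd gd fs gs fg; apply: AS_span => [x y ex ey|c x ex|x ex|q X].
- by rewrite !linD // ex ey.
- by rewrite !linZ // ex.
- by rewrite fd gd ex.
have -> : mon q (gen k X) = shS q (mon 0 (gen k X)) by rewrite shS_mon addr0.
by rewrite fs gs fg.
Qed.

Definition polyext (u : nat -> AS) (p : {poly k}) : AS := \sum_(i < size p) p`_i *: u i.

Lemma polyext_wide u (p : {poly k}) N : (size p <= N)%N ->
  polyext u p = \sum_(i < N) p`_i *: u i.
Proof.
move=> le; symmetry; apply: (@sum_ord_trunc _ (fun i => p`_i *: u i)) => // j lj.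
by rewrite nth_default ?scale0r.
Qed.

Lemma polyext_linear u : linear (polyext u).
Proof.
move=> c p r; pose N := (size (c *: p + r)%R + size p + size r)%N.
rewrite !(@polyext_wide _ _ N) /N; try by rewrite -addnA leq_addr.
- rewrite scaler_sumr -big_split; apply: eq_bigr => i _ /=.
  by rewrite coefD coefZ scalerDl scalerA.
- exact: leq_addl.
by rewrite addnAC leq_addl.
Qed.

Lemma polyextX u p : polyext u ('X * p) = polyext (fun i => u i.+1) p.
Proof.
rewrite (@polyext_wide _ _ (size p).+1); last first.
  by apply: leq_trans (size_polyMleq _ _) _; rewrite size_polyX.
rewrite big_ord_recl coefXM eqxx scale0r add0r; apply: eq_bigr => i _.
by rewrite lift0 coefXM.
Qed.

Lemma polyext1 u : polyext u 1 = u 0%N.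
Proof. by rewrite /polyext size_poly1 big_ord1 coef1 scale1r. Qed.

Lemma polyext_comb (u v : nat -> AS) (c : k) (F : AS -> AS) p : linear F ->
  polyext (fun i => F (u i) - c *: v i) p = F (polyext u p) - c *: polyext v p.
Proof.
move=> FL; rewrite /polyext (lin_sum FL) scaler_sumr -sumrB; apply: eq_bigr => i _.
by rewrite (linZ FL) scalerBr (scaler_swap p`_i c (v i)).
Qed.

Section Ext.
Variable w : 'I_4 -> AS.

(** The image of ∂^i X ⊗ t^q under the Ŝ-linear map that sends X ⊗ 1 to [w X] and commutes with the
    derivation; the Leibniz rule forces this recursion. *)
Fixpoint extU (X : 'I_4) (i : nat) (q : rat) : AS :=
  if i is i'.+1 then derS (extU X i' q) - ratr q *: extU X i' (q - 1)
  else shS q (w X).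

Definition extA q (a : A) : AS := \sum_X polyext (fun i => extU X i q) (a X).

Lemma extA_linear q : linear (extA q).
Proof.
move=> c a b; rewrite /extA scaler_sumr -big_split; apply: eq_bigr => X _ /=.
by rewrite !ffunE polyext_linear.
Qed.

Lemma extA_der q a : extA q (derA a) = derS (extA q a) - ratr q *: extA (q - 1) a.
Proof.
rewrite /extA (lin_sum (@derS_linear k)) scaler_sumr -sumrB; apply: eq_bigr => X _.
by rewrite derAE polyextX -(polyext_comb _ _ _ _ (@derS_linear k)).
Qed.

Definition ext : AS -> AS := mlin extA.

Lemma ext_linear : linear ext. Proof. exact: mlin_linear extA_linear. Qed.

Lemma ext_mon q a : ext (mon q a) = extA q a. Proof. exact: mlin_mon extA_linear q a. Qed.

Lemma ext_derS x : ext (derS x) = derS (ext x).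
Proof.
move: x; apply: linear_mon_eq => [||q a].
- by move=> c u v; rewrite derS_linear ext_linear.
- by move=> c u v; rewrite ext_linear derS_linear.
rewrite derS_mon (linD ext_linear) !ext_mon extA_der (linZ (extA_linear _)).
by rewrite subrK.
Qed.

Hypothesis hk : [pchar k] =i pred0.

(** Ŝ-linearity is not built into the recursion: the term p t^(p-1) from differentiating t^p cancels
    against the p in [ratr (p + q)]. *)
Lemma extU_sh X i p q : extU X i (p + q) = shS p (extU X i q).
Proof.
elim: i p q => [|i IH] p q /=; first by rewrite shSD.
have -> : p + q - 1 = p + (q - 1) by rewrite addrA.
rewrite (IH p q) (IH p (q - 1)) (linB (shS_linear p)) (derS_shS hk) (linZ (shS_linear p)).
rewrite (ratr0D hk) scalerDl opprD addrA addrAC -!addrA; apply: (congr1 (+%R _)).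
have -> : shS (p - 1) (extU X i q) = shS p (extU X i (q - 1)).
  by rewrite -(IH (p - 1)) -(IH p); apply: (congr1 (extU X i)); ring.
by rewrite addrCA subrr addr0.
Qed.

Lemma ext_shS p x : ext (shS p x) = shS p (ext x).
Proof.
move: x; apply: linear_mon_eq => [||q a].
- by move=> c u v; rewrite shS_linear ext_linear.
- by move=> c u v; rewrite ext_linear shS_linear.
rewrite shS_mon !ext_mon /extA (lin_sum (shS_linear p)); apply: eq_bigr => X _.
rewrite /polyext (lin_sum (shS_linear p)); apply: eq_bigr => i _.
by rewrite (linZ (shS_linear p)) extU_sh.
Qed.

Lemma ext_gen q X : ext (mon q (gen k X)) = shS q (w X).
Proof.
rewrite ext_mon /extA (bigD1 X) //= big1 ?addr0 => [|Z /negPf nZ].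
  by rewrite ffunE eqxx polyext1.
by rewrite ffunE nZ (lin0 (polyext_linear _)).
Qed.
End Ext.

Hypothesis hk : [pchar k] =i pred0.

Lemma parS_add b x y : parS b x -> parS b y -> parS b (x + y).
Proof. by move=> hx hy q Z hZ; rewrite coef_addS ffunE hx ?hy ?addr0. Qed.
Lemma parS_scale b c x : parS b x -> parS b (c *: x).
Proof. by move=> hx q Z hZ; rewrite coef_scaleS ffunE hx ?scaler0. Qed.
Lemma parS_opp b x : parS b x -> parS b (- x).
Proof. by rewrite -scaleN1r; exact: parS_scale. Qed.
Lemma parS_zero b : parS b (0 : AS).
Proof. by move=> q Z _; rewrite coef_zeroS ffunE. Qed.
Lemma parS_sum b (I : Type) (r : seq I) (F : I -> AS) :
  (forall i, parS b (F i)) -> parS b (\sum_(i <- r) F i).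
Proof. by move=> h; apply: (big_ind (parS b)) => //; [exact: parS_zero|exact: parS_add]. Qed.
Lemma parS_shS b p x : parS b x -> parS b (shS p x).
Proof. by move=> hx q Z hZ; rewrite coef_shS hx. Qed.
Lemma parS_mon b q a : parA b a -> parS b (mon q a).
Proof. by move=> ha r Z hZ; rewrite coef_mon; case: eqP; rewrite ?mulr1n ?ha // ffunE. Qed.
Lemma parA_gen (b : bool) (X : 'I_4) : (2 <= X)%N == b -> parA b (gen k X).
Proof.
by move=> /eqP <- Z hZ; rewrite ffunE; case: (eqVneq Z X) hZ => [->|//]; rewrite eqxx.
Qed.
Lemma parS_derS b x : parS b x -> parS b (derS x).
Proof.
move=> hx; rewrite (AS_sum_mon x) (lin_sum (@derS_linear k)); apply: parS_sum => q.
rewrite derS_mon; apply: parS_add; apply: parS_mon => Z hZ; rewrite ?derAE ?ffunE hx ?mulr0 ?scaler0 //.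
Qed.

Lemma ext_par w b x : (forall X : 'I_4, parS (2 <= X)%N (w X)) -> parS b x -> parS b (ext w x).
Proof.
move=> hw hx; rewrite /ext /mlin; apply: parS_sum => q; rewrite /extA.
apply: parS_sum => X; case: (eqVneq (2 <= X)%N b) => [e|ne]; last first.
  by rewrite hx // (lin0 (polyext_linear _)); exact: parS_zero.
rewrite /polyext; apply: parS_sum => i0; apply: parS_scale; rewrite -e.
move: (nat_of_ord i0) => {i0} i; elim: i q => [|i IH] q /=; first exact/parS_shS.
by apply: parS_add; [exact/parS_derS|exact/parS_opp/parS_scale].
Qed.

(** The right factor of an n-product is Ŝ-linear, so its power of t can be removed; the left factor
    is not, so t^p has to stay. *)
Lemma npr_hom_span (f : AS -> AS) : linear f ->
  (forall x, f (derS x) = derS (f x)) -> (forall q x, f (shS q x) = shS q (f x)) ->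
  (forall n p X Y, f (nprS n (mon p (gen k X)) (mon 0 (gen k Y))) =
     nprS n (f (mon p (gen k X))) (f (mon 0 (gen k Y)))) ->
  forall n x y, f (nprS n x y) = nprS n (f x) (f y).
Proof.
move=> fL fd fs fg n x y.
have nl := @nprS_linearl k; have nr := @nprS_linearr k.
move: x n y; apply: AS_span => [x y hx hy n z|c x hx n z|x hx n z|p X n y].
- by rewrite (linD (nl _ _)) !(linD fL) hx hy (linD (nl _ _)).
- by rewrite (linZ (nl _ _)) !(linZ fL) hx (linZ (nl _ _)).
- by rewrite (nprS_derl hk) (linN fL) (linZ fL) hx fd (nprS_derl hk).
move: y n; apply: AS_span => [x y hx hy n|c x hx n|x hx n|q Y n].
- by rewrite (linD (nr _ _)) !(linD fL) hx hy (linD (nr _ _)).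
- by rewrite (linZ (nr _ _)) !(linZ fL) hx (linZ (nr _ _)).
- by rewrite (nprS_derr hk) (linD fL) (linZ fL) !hx !fd hx (nprS_derr hk).
have -> : mon q (gen k Y) = shS q (mon 0 (gen k Y)) by rewrite shS_mon addr0.
by rewrite nprS_shr !fs fg nprS_shr.
Qed.

End FreeModule.

(** * Products of generators and the gauge automorphisms *)

Section Gauge.
Variable k : fieldType.
Local Notation A := (A k).
Local Notation AS := (AS k).
Local Notation gen := (gen k).
Local Notation dgen X := (derA (gen X)).

Definition tab0 (X Y : 'I_4) : A :=
  match nat_of_ord X, nat_of_ord Y with
  | 0, _ => dgen Y
  | 1, 2 => gen iP
  | 1, 3 => - gen iM
  | 2, 0 => Defs.half k *: dgen iP
  | 3, 0 => Defs.half k *: dgen iM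
  | 2, 1 => - gen iP
  | 3, 1 => gen iM
  | 2, 3 => gen iL + Defs.half k *: dgen iJ
  | 3, 2 => gen iL - Defs.half k *: dgen iJ
  | _, _ => 0
  end.

Definition tab1 (X Y : 'I_4) : A :=
  match nat_of_ord X, nat_of_ord Y with
  | 0, 0 => 2%:R *: gen iL
  | 0, 1 => gen iJ
  | 0, 2 => thalf k *: gen iP
  | 0, 3 => thalf k *: gen iM
  | 1, 0 => gen iJ
  | 2, 0 => thalf k *: gen iP
  | 3, 0 => thalf k *: gen iM
  | 2, 3 => gen iJ
  | 3, 2 => - gen iJ
  | _, _ => 0
  end.

Lemma genE X Z : gen X Z = (Z == X)%:R.
Proof. by rewrite ffunE; case: eqP. Qed.

Lemma nprA_tab0 X Y : nprA 0 (gen X) (gen Y) = tab0 X Y.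
Proof.
rewrite nprA_gen; apply/ffunP => Z; rewrite ffunE fact0 scale1r.
by elim/I4_ind: X; elim/I4_ind: Y; elim/I4_ind: Z;
  rewrite /brk /tab0 /= ?ffunE ?derAE ?genE /= ?ffunE ?derAE ?genE /=
   ?(coef0, coefN, coefD, coefB, coef1) /dd /lam /cst -?polyCM ?coefCM ?coefC ?coefX ?coef1 /=
   -?mul_polyC ?(mulr0, mul0r, addr0, add0r, subr0, oppr0, sub0r, mulr1) //=.
Qed.

Lemma nprA_tab1 X Y : nprA 1 (gen X) (gen Y) = tab1 X Y.
Proof.
rewrite nprA_gen; apply/ffunP => Z; rewrite ffunE (_ : (1`!)%:R = 1) // scale1r.
by elim/I4_ind: X; elim/I4_ind: Y; elim/I4_ind: Z;
  rewrite /brk /tab1 /= ?ffunE ?derAE ?genE /= ?ffunE ?derAE ?genE /=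
   ?(coef0, coefN, coefD, coefB, coef1) /dd /lam /cst -?polyCM ?coefCM ?coefC ?coefX ?coef1 /=
   -?mul_polyC ?(mulr0, mul0r, addr0, add0r, subr0, oppr0, sub0r, mulr1) //=.
Qed.

Hypothesis hk : [pchar k] =i pred0.

Lemma nprS_gen n p q X Y : nprS n (mon p (gen X)) (mon q (gen Y)) =
  match n with
  | 0 => mon (p + q) (tab0 X Y) + ratr p *: mon (p + q - 1) (tab1 X Y)
  | 1 => mon (p + q) (tab1 X Y)
  | _ => 0
  end.
Proof.
rewrite nprS_mon; case: n => [|[|n]].
- rewrite (@nprT_trunc _ _ _ _ _ _ 2) => [|j lj]; last by rewrite nprA_gen_ge2.
  rewrite !big_ord_recl big_ord0 addr0 /= nprA_tab0 nprA_tab1.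
  have -> : bump 0 0 = 1%N by [].
  by rewrite addr0 (binr0 hk) (binr1 hk) scale1r monZ.
- rewrite (@nprT_trunc _ _ _ _ _ _ 1) => [|j lj]; last by rewrite nprA_gen_ge2 ?addn_gt0.
  by rewrite big_ord1 /= nprA_tab1 (binr0 hk) scale1r ?subr0 ?addr0.
rewrite (@nprT_trunc _ _ _ _ _ _ 0) => [|j lj]; last by rewrite nprA_gen_ge2.
by rewrite big_ord0.
Qed.

(* The gauge transformation of r = b t^s, whose logarithmic derivative is s t^-1. *)
Definition gauge_gen (b : k) (s : rat) (X : 'I_4) : AS :=
  match nat_of_ord X with
  | 0 => mon 0 (gen iL) + ratr s *: mon (- 1) (gen iJ)
  | 1 => mon 0 (gen iJ)
  | 2 => b *: mon s (gen iP)
  | _ => b^-1 *: mon (- s) (gen iM)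
  end.

Definition gauge b s := ext (gauge_gen b s).

Section GaugeFixed.
Variables (b : k) (s : rat).
Local Notation v := (gauge b s).

Lemma gauge_linear : linear v. Proof. exact: ext_linear. Qed.
Lemma gauge_derS x : v (derS x) = derS (v x). Proof. exact: ext_derS. Qed.
Lemma gauge_shS p x : v (shS p x) = shS p (v x). Proof. exact: ext_shS. Qed.
Lemma gauge_par c x : parS c x -> parS c (v x).
Proof.
apply: ext_par; elim/I4_ind; rewrite /gauge_gen /=.
- by apply: parS_add; [|apply: parS_scale]; apply: parS_mon; exact: parA_gen.
- by apply: parS_mon; exact: parA_gen.
- by apply: parS_scale; apply: parS_mon; exact: parA_gen.
by apply: parS_scale; apply: parS_mon; exact: parA_gen.
Qed.

Lemma gauge_L q : v (mon q (gen iL)) = mon q (gen iL) + ratr s *: mon (q - 1) (gen iJ).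
Proof. by rewrite /gauge ext_gen /gauge_gen /= shS_add shSZ !shS_mon addr0. Qed.
Lemma gauge_J q : v (mon q (gen iJ)) = mon q (gen iJ).
Proof. by rewrite /gauge ext_gen /gauge_gen /= !shS_mon addr0. Qed.
Lemma gauge_P q : v (mon q (gen iP)) = b *: mon (q + s) (gen iP).
Proof. by rewrite /gauge ext_gen /gauge_gen /= shSZ !shS_mon. Qed.
Lemma gauge_M q : v (mon q (gen iM)) = b^-1 *: mon (q - s) (gen iM).
Proof. by rewrite /gauge ext_gen /gauge_gen /= shSZ !shS_mon. Qed.

Lemma gauge_dgen q X : v (mon q (dgen X)) =
  derS (v (mon q (gen X))) + (- ratr q) *: v (mon (q - 1) (gen X)).
Proof. by rewrite mon_derA (linD gauge_linear) (linZ gauge_linear) gauge_derS. Qed.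
End GaugeFixed.

(** Read at a fixed exponent and generator, an identity in A ⊗ Ŝ becomes one in the commutative ring
    k[∂]. *)
Definition ev (r : rat) (Z : 'I_4) (x : AS) : {poly k} := x@_r Z.
Lemma evP x y : (forall r Z, ev r Z x = ev r Z y) -> x = y.
Proof. by move=> h; apply: ASP => q; apply/ffunP => Z; exact: h. Qed.
Lemma evD r Z x y : ev r Z (x + y) = ev r Z x + ev r Z y.
Proof. by rewrite /ev coef_addS ffunE. Qed.
Lemma evN r Z x : ev r Z (- x) = - ev r Z x.
Proof. by rewrite /ev coef_oppS ffunE. Qed.
Lemma evZ r Z c x : ev r Z (c *: x) = c%:P * ev r Z x.
Proof. by rewrite /ev coef_scaleS ffunE mul_polyC. Qed.
Lemma ev0 r Z : ev r Z 0 = 0.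
Proof. by rewrite /ev coef_zeroS ffunE. Qed.
Lemma ev_mon r Z q a : ev r Z (mon q a) = (q == r)%:R * a Z.
Proof. by rewrite /ev coef_mon; case: eqP; rewrite ?mul1r ?mul0r // mulr0n ffunE. Qed.

Lemma thalfE : thalf k = 1 + Defs.half k.
Proof.
rewrite /thalf /Defs.half; have h2 : 2%:R != 0 :> k by rewrite natr0_eq0.
by field.
Qed.
End Gauge.

#[local] Opaque ev gauge.

(** Exponents equal to c get the same syntactic form, so that [ring] treats equal monomials as one
    atom. *)
Ltac canon c := repeat match goal with |- context [mon ?e _] =>
  tryif constr_eq e c then fail else (have -> : e = c by ring) end.

Section GaugeHom.
Variable k : fieldType.
Hypothesis hk : [pchar k] =i pred0.
Variables (b : k) (s : rat).
Hypothesis b0 : b != 0.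
Local Notation v := (gauge b s).

Ltac push_ev := repeat first
  [rewrite -> evD | rewrite -> evZ | rewrite -> evN | rewrite -> ev_mon | rewrite -> ev0].

Lemma gauge_nprS_gen n p X Y :
  v (nprS n (mon p (gen k X)) (mon 0 (gen k Y))) =
  nprS n (v (mon p (gen k X))) (v (mon 0 (gen k Y))).
Proof.
have vL := gauge_linear b s.
have nl := @nprS_linearl k; have nr := @nprS_linearr k.
(* The scalars of G^+ and G^- meet in their products and must cancel. *)
have bV : b%:P * (b^-1)%:P = 1 :> {poly k} by rewrite -polyCM divff.
have bV' : (b^-1)%:P * b%:P = 1 :> {poly k} by rewrite mulrC.
rewrite (nprS_gen hk).
case: n => [|[|n]].
- elim/I4_ind: X; elim/I4_ind: Y; rewrite ?gauge_L ?gauge_J ?gauge_P ?gauge_M;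
  rewrite ?(linD (nl _ _)) ?(linZ (nl _ _)) ?(linD (nr _ _)) ?(linZ (nr _ _)) !(nprS_gen hk);
  rewrite /tab0 /tab1 /= ?(monD, monZ, monN, mon0) ?(linD vL, linZ vL, linN vL, lin0 vL);
  rewrite ?gauge_dgen ?gauge_L ?gauge_J ?gauge_P ?gauge_M ?(derSD, derSZ) ?derS_mon ?monZ;
  rewrite ?(ratr0D hk, ratr0N hk, ratr01 hk, ratr00 hk);
  canon p; canon (p - 1); canon (p - 1 - 1); canon (p + s); canon (p + s - 1);
  canon (p - s); canon (p - s - 1); apply: evP => r Z; push_ev; rewrite ?(thalfE hk);
  (ring || ring: bV bV').
- elim/I4_ind: X; elim/I4_ind: Y; rewrite ?gauge_L ?gauge_J ?gauge_P ?gauge_M;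
  rewrite ?(linD (nl _ _)) ?(linZ (nl _ _)) ?(linD (nr _ _)) ?(linZ (nr _ _)) !(nprS_gen hk);
  rewrite /tab1 /= ?(monD, monZ, monN, mon0) ?(linD vL, linZ vL, linN vL, lin0 vL);
  rewrite ?gauge_L ?gauge_J ?gauge_P ?gauge_M;
  canon p; canon (p - 1); canon (p + s); canon (p - s);
  apply: evP => r Z; push_ev; (ring || ring: bV bV').
elim/I4_ind: X; elim/I4_ind: Y; rewrite ?gauge_L ?gauge_J ?gauge_P ?gauge_M;
rewrite ?(linD (nl _ _)) ?(linZ (nl _ _)) ?(linD (nr _ _)) ?(linZ (nr _ _)) !(nprS_gen hk);
rewrite (lin0 vL) ?(scaler0, addr0); reflexivity.
Qed.

Lemma gauge_nprS n x y : v (nprS n x y) = nprS n (v x) (v y).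
Proof.
exact: (npr_hom_span hk (gauge_linear b s) (gauge_derS b s) (gauge_shS hk b s) gauge_nprS_gen).
Qed.

Lemma gaugeK : cancel v (gauge b^-1 (- s)).
Proof.
have vL := gauge_linear b s; have wL := gauge_linear b^-1 (- s).
apply: (linear_span_eq (z := fun=> 1)) => [c x y|c x y|x|//|q x|q x|].
- by rewrite vL wL.
- by [].
- by rewrite !gauge_derS.
- by rewrite !(gauge_shS hk) scale1r.
- by rewrite scale1r.
elim/I4_ind; rewrite ?gauge_L ?gauge_J ?gauge_P ?gauge_M ?(linD wL, linZ wL).
- rewrite gauge_L gauge_J (ratr0N hk) scaleNr addrNK; reflexivity.
- by [].
- by rewrite gauge_P scalerA divff // scale1r addrK.
by rewrite gauge_M invrK scalerA mulVf // scale1r opprK subrK.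
Qed.
End GaugeHom.

(** * The involution ω as a conformal automorphism *)

Section Omega.
Variable k : fieldType.
Local Notation A := (A k).
Local Notation AS := (AS k).

Lemma omegaA_L (a : A) : omegaA a iL = a iL.
Proof. by rewrite ffunE /= inord4E. Qed.
Lemma omegaA_J (a : A) : omegaA a iJ = - a iJ.
Proof. by rewrite ffunE /= inord4E. Qed.
Lemma omegaA_P (a : A) : omegaA a iP = a iM.
Proof. by rewrite ffunE /= inord4E. Qed.
Lemma omegaA_M (a : A) : omegaA a iM = a iP.
Proof. by rewrite ffunE /= inord4E. Qed.
Definition omegaAE := (omegaA_L, omegaA_J, omegaA_P, omegaA_M).

Lemma omegaA_linear : linear (@omegaA k).
Proof.
move=> c a b; apply/ffunP; elim/I4_ind; rewrite !(omegaAE, ffunE) ?omegaAE //.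
by rewrite opprD scalerN.
Qed.

Lemma omegaAK : involutive (@omegaA k).
Proof. by move=> a; apply/ffunP; elim/I4_ind; rewrite !omegaAE ?opprK. Qed.

Lemma omegaA_nprA n (a b : A) : omegaA (nprA n a b) = nprA n (omegaA a) (omegaA b).
Proof.
have E Z (c : k) (W : 'I_4) : lbrA (omegaA a) (omegaA b) Z = cst c * lbrA a b W ->
   nprA n (omegaA a) (omegaA b) Z = c *: nprA n a b W.
  by move=> e; rewrite !nprAE e coef_cstM !scalerA mulrC.
have EL : lbrA (omegaA a) (omegaA b) iL = cst 1 * lbrA a b iL.
  by rewrite !lbrAE !sum_I4 !omegaAE !levN /brk /= /cst; ring.
have EJ : lbrA (omegaA a) (omegaA b) iJ = cst (-1) * lbrA a b iJ.
  by rewrite !lbrAE !sum_I4 !omegaAE !levN /brk /= /cst; ring.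
have EP : lbrA (omegaA a) (omegaA b) iP = cst 1 * lbrA a b iM.
  by rewrite !lbrAE !sum_I4 !omegaAE !levN /brk /= /cst; ring.
have EM : lbrA (omegaA a) (omegaA b) iM = cst 1 * lbrA a b iP.
  by rewrite !lbrAE !sum_I4 !omegaAE !levN /brk /= /cst; ring.
apply/ffunP; elim/I4_ind; rewrite omegaAE.
- by rewrite (E _ _ _ EL) scale1r.
- by rewrite (E _ _ _ EJ) scaleN1r.
- by rewrite (E _ _ _ EP) scale1r.
by rewrite (E _ _ _ EM) scale1r.
Qed.

Lemma omegaA_conf_aut : conf_autA (@omegaA k).
Proof.
split; first by exists (@omegaA k); exact: omegaAK.
split; first exact: omegaA_linear.
split; first by move=> b a ha; elim/I4_ind => hZ; rewrite omegaAE ha // oppr0.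
split; last by move=> n a b; exact: omegaA_nprA.
by move=> a; apply/ffunP; elim/I4_ind; rewrite !(omegaAE, derAE) // mulrN.
Qed.

Lemma omegaA_gen : (omegaA (gen k iL) = gen k iL) * (omegaA (gen k iJ) = - gen k iJ) *
  (omegaA (gen k iP) = gen k iM) * (omegaA (gen k iM) = gen k iP).
Proof.
by do !split; apply/ffunP; elim/I4_ind; rewrite omegaAE !ffunE /= ?oppr0.
Qed.
End Omega.

(** * Units of k[t^Q] *)

Lemma seq_min (s : seq rat) (P : pred rat) : has P s ->
  exists p0, [/\ p0 \in s, P p0 & forall p, p \in s -> P p -> p0 <= p].
Proof.
move=> hP; have [|p0 [/mapP[q0 q0s ->] Pq mx]] := @seq_max (map -%R s) (fun p => P (- p)).
  by rewrite has_map; apply: sub_has hP => p /=; rewrite opprK.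
exists q0; split=> //; first by rewrite opprK in Pq.
by move=> p ps Pp; rewrite -lerN2; apply: mx; rewrite ?map_f // opprK.
Qed.

(** From f h = 1, the largest exponents of f and h add up to 0, and so do the smallest; hence the
    largest and smallest exponents of f coincide and f, h are monomials. *)
Lemma conv_unit (K : fieldType) (P Q : seq rat) (f h : rat -> K) :
  uniq P -> uniq Q ->
  (forall r, \sum_(p <- P) \sum_(q <- Q) (f p * h q) *+ (p + q == r) = (r == 0)%:R) ->
  exists p0, [/\ f p0 * h (- p0) = 1, forall p, p \in P -> p != p0 -> f p = 0
    & forall q, q \in Q -> q != - p0 -> h q = 0].
Proof.
move=> uP uQ H.
have hf : has (fun p => f p != 0) P.
  apply: contraT => /hasPn nf; have := H 0; rewrite eqxx big1_seq => [/eqP|p /= pP].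
    by rewrite eq_sym oner_eq0.
  by rewrite big1 // => q _; move/negPn/eqP: (nf p pP) => ->; rewrite mul0r mul0rn.
have hh : has (fun q => h q != 0) Q.
  apply: contraT => /hasPn nh; have := H 0; rewrite eqxx big1 => [/eqP|p _].
    by rewrite eq_sym oner_eq0.
  by rewrite big1_seq // => q /= qQ; move/negPn/eqP: (nh q qQ) => ->; rewrite mulr0 mul0rn.
have [p1 [p1P fp1 p1x]] := seq_max hf; have [q1 [q1Q hq1 q1x]] := seq_max hh.
have [p2 [p2P fp2 p2n]] := seq_min hf; have [q2 [q2Q hq2 q2n]] := seq_min hh.
have top : p1 + q1 = 0 /\ f p1 * h q1 = 1.
  have := H (p1 + q1); rewrite conv_single // => [|p q pP qQ fp hq e].
    case: eqP => [-> //|_ /eqP]; by rewrite mulf_eq0 (negPf fp1) (negPf hq1).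
  apply/eqP; rewrite eq_le p1x //= -(lerD2r q) e lerD2l; exact: q1x.
have bot : p2 + q2 = 0.
  have := H (p2 + q2); rewrite conv_single // => [|p q pP qQ fp hq e].
    case: eqP => [-> //|_ /eqP]; by rewrite mulf_eq0 (negPf fp2) (negPf hq2).
  apply/eqP; rewrite eq_le p2n // andbT -(lerD2r q) e lerD2l; exact: q2n.
have q1E : q1 = - p1 by apply/eqP; rewrite -addr_eq0 addrC top.1.
have q2E : q2 = - p2 by apply/eqP; rewrite -addr_eq0 addrC bot.
have p12 : p1 = p2.
  apply/eqP; rewrite eq_le [p2 <= p1]p2n // andbT.
  by rewrite -lerN2 -q1E -q2E q2n.
exists p1; split; first by rewrite -q1E top.2.
- move=> p pP np; apply/eqP; apply: contraNT np => fp.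
  by rewrite eq_le p1x // {1}p12 p2n.
move=> q qQ nq; apply/eqP; apply: contraNT nq => hq.
by rewrite eq_le -{1}q1E q1x //= p12 -q2E q2n.
Qed.

(** * The semilinear operators s ⊗ γ on A ⊗ Ŝ *)

Section Twist.
Variables (k : fieldType) (z : rat -> k).
Hypothesis zD : forall p q, z (p + q) = z p * z q.
Hypothesis zint : forall i : int, z i%:~R = 1.
Local Notation A := (A k).
Local Notation AS := (AS k).
Variable s : A -> A.
Hypothesis sL : linear s.
Hypothesis sd : forall a, s (derA a) = derA (s a).

Definition twist : AS -> AS := mlin (fun q a => mon q (z q *: s a)).

Fact twist_summand_linear q : linear (fun a => mon q (z q *: s a)).
Proof. by move=> c a b; rewrite sL scalerDr monD scaler_swap [mon q (c *: _)]monZ. Qed.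

Lemma twist_linear : linear twist. Proof. exact: mlin_linear twist_summand_linear. Qed.

Lemma twist_mon q a : twist (mon q a) = z q *: mon q (s a).
Proof. by rewrite /twist (mlin_mon twist_summand_linear) monZ. Qed.

Lemma coef_twist x q : (twist x)@_q = z q *: s x@_q.
Proof.
apply: (linear_mon_eq (f := fun x => (twist x)@_q) (g := fun x : AS => z q *: s x@_q)).
- by move=> c u v; rewrite twist_linear coef_addS coef_scaleS.
- by move=> c u v; rewrite coef_addS coef_scaleS sL scalerDr scaler_swap.
move=> p a; rewrite twist_mon coef_scaleS !coef_mon.
by case: eqP => [->|_]; rewrite ?mulr1n // mulr0n (lin0 sL) !scaler0.
Qed.

(** Derivation and n-products lower exponents by natural numbers only, where the character z is
    trivial; this is why γ is compatible with them. *)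
Lemma z_sub_nat q (n : nat) : z (q - n%:R) = z q.
Proof. by rewrite zD -(mulrNz _ n) zint mulr1. Qed.

Lemma twist_derS x : twist (derS x) = derS (twist x).
Proof.
move: x; apply: linear_mon_eq => [||q a].
- by move=> c u v; rewrite derS_linear twist_linear.
- by move=> c u v; rewrite twist_linear derS_linear.
rewrite derS_mon (linD twist_linear) !twist_mon derSZ derS_mon sd (z_sub_nat q 1).
by rewrite (linZ sL) scalerDr.
Qed.

Lemma twist_shS p x : twist (shS p x) = z p *: shS p (twist x).
Proof.
apply: (linear_mon_eq (f := fun x => twist (shS p x)) (g := fun x => z p *: shS p (twist x))).
- by move=> c u v; rewrite shS_linear twist_linear.
- by move=> c u v; rewrite twist_linear shS_linear scalerDr scaler_swap.
by move=> q a; rewrite shS_mon !twist_mon shSZ shS_mon zD scalerA.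
Qed.

Lemma twist_nprS n x y : (forall n a b, s (nprA n a b) = nprA n (s a) (s b)) ->
  twist (nprS n x y) = nprS n (twist x) (twist y).
Proof.
move=> sn; move: x y; apply: bilinear_mon_eq => [y|x|y|x|p a q b].
- by move=> c u v; rewrite nprS_linearl twist_linear.
- by move=> c u v; rewrite nprS_linearr twist_linear.
- by move=> c u v; rewrite twist_linear nprS_linearl.
- by move=> c u v; rewrite twist_linear nprS_linearr.
rewrite !twist_mon (linZ (nprS_linearl _ _)) (linZ (nprS_linearr _ _)) !nprS_mon.
have hb j : (bndA a + bndA b + 2 <= j)%N -> nprA (n + j) a b = 0.
  by move=> lj; apply: nprA_bound; apply: leq_trans lj (leq_addl _ _).
rewrite (nprT_trunc _ _ hb) (@nprT_trunc _ _ _ _ (s a) (s b) (bndA a + bndA b + 2)%N); last first.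
  by move=> j lj; rewrite -sn hb // (lin0 sL).
rewrite (lin_sum twist_linear) scalerA scaler_sumr; apply: eq_bigr => j _.
by rewrite twist_mon z_sub_nat zD (linZ sL) sn.
Qed.

Lemma twist_par b x : (forall b a, parA b a -> parA b (s a)) -> parS b x -> parS b (twist x).
Proof.
move=> sp hx q; rewrite coef_twist => Z hZ; rewrite ffunE (sp b) ?scaler0 //; exact: hx.
Qed.
End Twist.

#[local] Opaque twist.

(** * The character ζ of Q with kernel Z given by the compatible roots of unity *)

Section RootsOfUnity.
Variables (k : closedFieldType) (xi : nat -> k).
Hypothesis hxi : forall m : nat, (0 < m)%N -> m.-primitive_root (xi m).
Hypothesis hcomp : forall m n : nat, (0 < m)%N -> (0 < n)%N -> xi (m * n)%N ^+ n = xi m.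

Definition zeta (q : rat) : k := xi `|denq q| ^ numq q.

Lemma xi_neq0 m : (0 < m)%N -> xi m != 0.
Proof.
move=> m0; apply/eqP => e; have := prim_expr_order (hxi m0).
by rewrite e expr0n eqn0Ngt m0 => /esym/eqP; rewrite oner_eq0.
Qed.

Lemma absz_denq_gt0 q : (0 < `|denq q|)%N.
Proof. by rewrite absz_gt0 denq_eq0. Qed.

(** Compatibility of the ξ_m makes the value independent of the denominator: i/m arises from the
    reduced fraction n/d by a factor u, and ξ_(du)^u = ξ_d. *)
Lemma zeta_frac (i : int) (m : nat) : (0 < m)%N -> zeta (i%:~R / m%:R) = xi m ^ i.
Proof.
move=> m0; set q := i%:~R / m%:R : rat; set d := `|denq q|%N; set n := numq q.
have d0 : (0 < d)%N := absz_denq_gt0 q.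
have dE : denq q = d by rewrite absz_denq.
have e : i * d%:Z = n * m%:Z.
  apply: (@intr_inj rat); rewrite !rmorphM /= -dE.
  have h1 : (denq q)%:~R != 0 :> rat by rewrite intr_eq0 denq_eq0.
  have h2 : m%:R != 0 :> rat by rewrite pnatr_eq0 -lt0n.
  have := divq_num_den q; rewrite {3}/q => /eqP; rewrite eqr_div // => /eqP <-.
  by [].
have cop : coprime `|n| d := coprime_num_den q.
have /dvdnP [u mE] : (d %| m)%N.
  rewrite -(Gauss_dvdr m (n := `|n|)) 1?coprime_sym //.
  have -> : (`|n| * m = `|i| * d)%N by rewrite -[m]/(`|m%:Z|%N) -abszM -e abszM.
  exact: dvdn_mull.
have u0 : (0 < u)%N by move: m0; rewrite mE muln_gt0 => /andP[].
have iE : i = n * u%:Z.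
  have dz : d%:Z != 0 by rewrite -lt0n.
  by apply: (mulIf dz); rewrite e mE PoszM mulrA.
rewrite /zeta -/d -/n iE [in RHS]mE mulnC mulrC -exprz_exp -exprnP hcomp //.
Qed.

Lemma rat_common_nat (p q : rat) : exists a b : int, exists m : nat,
  [/\ (0 < m)%N, p = a%:~R / m%:R & q = b%:~R / m%:R].
Proof.
exists (numq p * denq q), (numq q * denq p), (`|denq p| * `|denq q|)%N.
have hp : (denq p)%:~R != 0 :> rat by rewrite intr_eq0 denq_eq0.
have hq : (denq q)%:~R != 0 :> rat by rewrite intr_eq0 denq_eq0.
have E (r : rat) : (`|denq r|%N)%:R = (denq r)%:~R :> rat by rewrite -[in RHS]absz_denq.
split; first by rewrite muln_gt0 !absz_denq_gt0.
  rewrite natrM !E -{1}[p]divq_num_den !rmorphM /=; by field; rewrite ?hp ?hq.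
rewrite natrM !E -{1}[q]divq_num_den !rmorphM /=; by field; rewrite ?hp ?hq.
Qed.

Lemma zetaD p q : zeta (p + q) = zeta p * zeta q.
Proof.
have [a [b [m [m0 -> ->]]]] := rat_common_nat p q.
rewrite -mulrDl -rmorphD /= !zeta_frac // expfzDr ?xi_neq0 //.
Qed.

Lemma zeta_int (i : int) : zeta i%:~R = 1.
Proof.
have := zeta_frac i (ltn0Sn 0); rewrite divr1 => ->.
by have := prim_expr_order (hxi (ltn0Sn 0)); rewrite expr1 => ->; rewrite exp1rz.
Qed.

Lemma zeta0 : zeta 0 = 1. Proof. exact: (zeta_int 0). Qed.

Lemma zeta_mulN q : zeta q * zeta (- q) = 1.
Proof. by rewrite -zetaD subrr zeta0. Qed.

Lemma zeta_neq0 q : zeta q != 0.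
Proof. by apply/eqP => e; have /eqP := zeta_mulN q; rewrite e mul0r eq_sym oner_eq0. Qed.

Lemma zetaN q : zeta (- q) = (zeta q)^-1.
Proof. by apply: (mulfI (zeta_neq0 q)); rewrite zeta_mulN divff ?zeta_neq0. Qed.

Lemma zetaMn q n : zeta (q *+ n) = zeta q ^+ n.
Proof.
elim: n => [|n IH]; first by rewrite mulr0n zeta0.
by rewrite mulrS zetaD IH exprS.
Qed.

(** The order of ξ_d is exactly d, so d divides the numerator, which is coprime to it; hence d =
    1. *)
Lemma zeta_eq1 q : zeta q = 1 -> exists i : int, q = i%:~R.
Proof.
move=> e; exists (numq q); have d0 := absz_denq_gt0 q.
have : xi `|denq q| ^+ `|numq q| = 1.
  move: e; rewrite /zeta; case: (numq q) => n //=.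
  by rewrite NegzE -exprz_inv -exprnP exprVn => /eqP; rewrite invr_eq1 => /eqP.
move/eqP; rewrite -(prim_order_dvd (hxi d0)) => dv.
have : (`|denq q| %| 1)%N by rewrite -(eqP (coprime_num_den q)) dvdn_gcd dv dvdnn.
rewrite dvdn1 => /eqP d1.
by rewrite -{1}[q]divq_num_den -absz_denq d1 divr1.
Qed.

Lemma zeta_root c n : (0 < n)%N -> c ^+ n = 1 -> exists r, zeta r = c.
Proof.
move=> n0 cn; have [i ->] := prim_rootP (hxi n0) cn.
by exists ((i : nat)%:~R / n%:R); rewrite zeta_frac.
Qed.
End RootsOfUnity.

(** * Images of G^+ and G^- as reciprocal monomials *)

Section UnitPair.
Variable k : fieldType.
Hypothesis hk : [pchar k] =i pred0.
Local Notation AS := (AS k).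
Local Notation gen := (gen k).

(** Products of generators vanish from n = 2 on, so the 1-product of u = f U and w = h W is f h e J;
    the hypothesis thus says f h = 1. The sign e allows for either order of G^+ and G^-. *)
Lemma unit_pair (u w : AS) (U W : 'I_4) (e : k) : e != 0 -> tab1 k U W = e *: gen iJ ->
  (forall q, exists c, u@_q = c *: gen U) -> (forall q, exists c, w@_q = c *: gen W) ->
  nprS 1 u w = e *: mon 0 (gen iJ) ->
  exists q (c : k), [/\ c != 0, u = c *: mon q (gen U) & w = c^-1 *: mon (- q) (gen W)].
Proof.
move=> e0 tE hu hw huw.
pose f q := (u@_q U)`_0; pose h q := (w@_q W)`_0.
have uE q : u@_q = f q *: gen U.
  have [c uq] := hu q; rewrite /f uq; apply: (congr1 (fun x => x *: gen U)).
  by rewrite ffunE genE eqxx coefZ coef1 mulr1.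
have wE q : w@_q = h q *: gen W.
  have [c wq] := hw q; rewrite /h wq; apply: (congr1 (fun x => x *: gen W)).
  by rewrite ffunE genE eqxx coefZ coef1 mulr1.
have nE n p q : nprA n u@_p w@_q = (f p * h q) *: nprA n (gen U) (gen W).
  by rewrite uE wE (linZ (nprA_linearl n _)) (linZ (nprA_linearr n (gen U))) scalerA.
have conv r : \sum_(p <- msupp u) \sum_(q <- msupp w) (f p * h q) *+ (p + q == r) = (r == 0)%:R.
  apply: (mulfI e0); transitivity (((nprS 1 u w)@_r iJ)`_0); last first.
    rewrite huw coef_scaleS coef_mon [0 == r]eq_sym ffunE.
    by case: eqP => _; rewrite ?mulr1n ?mulr0n ?ffunE coefZ ?coef0 // coef1.
  rewrite (coef_nprS_top hk); last first.
    by move=> p q j j0; rewrite nE nprA_gen_ge2 ?scaler0 ?ffunE ?coef0 // add1n ltnS.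
  rewrite mulr_sumr; apply: eq_bigr => p _; rewrite mulr_sumr; apply: eq_bigr => q _.
  by rewrite nE nprA_tab1 tE !ffunE /= !coefZ coef1 mulr1 mulrnAr mulrC.
have [q [fh fz hz]] := conv_unit (fset_uniq _) (fset_uniq _) conv.
have f0 : f q != 0 by apply/eqP => f0; move/eqP: fh; rewrite f0 mul0r eq_sym oner_eq0.
exists q, (f q); split=> //; apply: ASP => r; rewrite coef_scaleS coef_mon ?uE ?wE.
- rewrite eq_sym; case: (eqVneq r q) => [->|nr]; first by rewrite mulr1n.
  rewrite mulr0n scaler0; case: (boolP (r \in msupp u)) => [ru|/mcoeff_outdom ru].
    by rewrite fz ?scale0r.
  by rewrite /f ru ffunE coef0 scale0r.
rewrite eq_sym; case: (eqVneq r (- q)) => [->|nr].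
  rewrite mulr1n; apply: (congr1 (fun x => x *: gen W)); apply: (mulfI f0).
  by rewrite fh divff.
rewrite mulr0n scaler0; case: (boolP (r \in msupp w)) => [ru|/mcoeff_outdom ru].
  by rewrite hz ?scale0r.
by rewrite /h ru ffunE coef0 scale0r.
Qed.
End UnitPair.

(** * Classification of locally finite semilinear automorphisms *)

Section Classification.
Variables (k : closedFieldType) (xi : nat -> k).
Hypothesis hk : [pchar k] =i pred0.
Hypothesis hxi : forall m : nat, (0 < m)%N -> m.-primitive_root (xi m).
Hypothesis hcomp : forall m n : nat, (0 < m)%N -> (0 < n)%N -> xi (m * n)%N ^+ n = xi m.
Local Notation AS := (AS k).
Local Notation gen := (gen k).
Local Notation z := (zeta xi).
Local Notation T X := (mon 0 (gen X)).

Let zD := zetaD hxi hcomp.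
Let zi := zeta_int hxi hcomp.

Lemma gen_neq0 X : gen X != 0.
Proof. by apply/eqP => /ffunP /(_ X); rewrite genE ffunE eqxx => /eqP; rewrite oner_eq0. Qed.

Lemma mon_gen_neq0 q X : mon q (gen X) <> 0.
Proof.
move=> e; have := congr1 (fun x : AS => x@_q) e; rewrite /= coef_mon eqxx coef_zeroS.
exact/eqP/gen_neq0.
Qed.

Lemma two_neq0 : 2%:R != 0 :> k. Proof. by rewrite natr0_eq0. Qed.

Lemma mon_J_sign : mon 0 (- gen iJ) <> T iJ.
Proof.
move=> e; have e2 : 2%:R *: T iJ = 0 by rewrite scaler_nat mulr2n -{1}e monN addNr.
case: (@mon_gen_neq0 0 iJ); move/eqP: e2; rewrite scaler_eq0 (negPf two_neq0) /=.
by move/eqP.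
Qed.

Lemma npr_JP n : nprS n (T iJ) (T iP) = if n is 0 then T iP else 0.
Proof.
rewrite (nprS_gen hk) addr0; case: n => [|[|n]] //; rewrite /tab0 /tab1 /= ?mon0 //.
by rewrite scaler0 addr0.
Qed.
Lemma npr_JM n : nprS n (T iJ) (T iM) = if n is 0 then - T iM else 0.
Proof.
rewrite (nprS_gen hk) addr0; case: n => [|[|n]] //; rewrite /tab0 /tab1 /= ?mon0 //.
by rewrite scaler0 addr0 monN.
Qed.
Lemma npr1_PM : nprS 1 (T iP) (T iM) = T iJ.
Proof. by rewrite (nprS_gen hk) addr0. Qed.
Lemma L_expr : T iL = nprS 0 (T iP) (T iM) - Defs.half k *: derS (T iJ).
Proof.
rewrite (nprS_gen hk) addr0 (ratr00 hk) scale0r addr0 /tab0 /= derS_mon (ratr00 hk).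
by rewrite scale0r mon0 addr0 monD monZ addrK.
Qed.

Section Tau.
Variable tau : AS -> AS.
Hypothesis tL : linear tau.
Hypothesis td : forall x, tau (derS x) = derS (tau x).
Hypothesis ts : forall p x, tau (shS p x) = z p *: shS p (tau x).
Hypothesis tn : forall n x y, tau (nprS n x y) = nprS n (tau x) (tau y).
Hypothesis tp : forall b x, parS b x -> parS b (tau x).
Hypothesis tf : forall x, exists2 M, (0 < M)%N & iter M tau x = x.

(** Some positive iterate of τ returns x, so τ x = 0 would give x = 0. *)
Lemma tau_neq0 x : x <> 0 -> tau x <> 0.
Proof.
move=> x0 e; case: x0; have [[|M] // _ <-] := tf x.
rewrite iterSr e; elim: M => //= M ->; exact: lin0.
Qed.

Lemma parS_gen b X : (2 <= nat_of_ord X)%N == b -> parS b (T X).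
Proof. by move=> h; apply: parS_mon; exact: parA_gen. Qed.

(** Both (J, G^+) and (-J, G^-) satisfy the hypotheses of [eigenpair], which τ preserves. The two
    answers must agree on the sign of τ J, which fixes the lines containing τ G^+ and τ G^-. *)
Lemma tau_gens :
  (exists q (c : k), [/\ c != 0, tau (T iJ) = T iJ, tau (T iP) = c *: mon q (gen iP)
     & tau (T iM) = c^-1 *: mon (- q) (gen iM)]) \/
  (exists q (c : k), [/\ c != 0, tau (T iJ) = - T iJ, tau (T iP) = c *: mon q (gen iM)
     & tau (T iM) = c^-1 *: mon (- q) (gen iP)]).
Proof.
have pJ : parS false (tau (T iJ)) by apply: tp; exact: parS_gen.
have pP : parS true (tau (T iP)) by apply: tp; exact: parS_gen.
have pM : parS true (tau (T iM)) by apply: tp; exact: parS_gen.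
have nP : tau (T iP) <> 0 by apply: tau_neq0; exact: mon_gen_neq0.
have nM : tau (T iM) <> 0 by apply: tau_neq0; exact: mon_gen_neq0.
have P0 : nprS 0 (tau (T iJ)) (tau (T iP)) = tau (T iP) by rewrite -tn npr_JP.
have PS n : nprS n.+1 (tau (T iJ)) (tau (T iP)) = 0 by rewrite -tn npr_JP (lin0 tL).
have M0 : nprS 0 (- tau (T iJ)) (tau (T iM)) = tau (T iM).
  by rewrite (linN (nprS_linearl _ _)) -tn npr_JM (linN tL) opprK.
have MS n : nprS n.+1 (- tau (T iJ)) (tau (T iM)) = 0.
  by rewrite (linN (nprS_linearl _ _)) -tn npr_JM (lin0 tL) oppr0.
have PM : nprS 1 (tau (T iP)) (tau (T iM)) = tau (T iJ) by rewrite -tn npr1_PM.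
have eP := eigenpair hk pJ pP nP P0 PS.
have eM := eigenpair hk (parS_opp pJ) pM nM M0 MS.
case: eP => -[eJ hP]; rewrite eJ in eM PM; [left|right].
- case: eM => -[eJ' hM]; first by case: mon_J_sign; rewrite monN.
  have [||q [c [c0 uE wE]]] := unit_pair hk (oner_neq0 k) _ hP hM.
  + by rewrite scale1r.
  + by rewrite scale1r.
  by exists q, c.
case: eM => -[eJ' hM]; last by case: mon_J_sign; rewrite -eJ' monN opprK.
have n1 : -1 != 0 :> k by rewrite oppr_eq0 oner_eq0.
have [||q [c [c0 uE wE]]] := unit_pair hk n1 _ hP hM.
+ by rewrite scaleN1r.
+ by rewrite scaleN1r -monN.
by exists q, c; split=> //; rewrite eJ monN.
Qed.

(** L is omitted from the hypothesis because [L_expr] expresses it through J and G^±. *)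
Lemma intertwine (b : k) s (sg : A k -> A k) : b != 0 -> linear sg ->
  (forall a, sg (derA a) = derA (sg a)) ->
  (forall n a a', sg (nprA n a a') = nprA n (sg a) (sg a')) ->
  (forall X, X != iL -> gauge b s (tau (T X)) = twist z sg (gauge b s (T X))) ->
  forall x, gauge b s (tau x) = twist z sg (gauge b s x).
Proof.
move=> b0 sgL sgd sgn H.
have vL := gauge_linear b s; have wL := twist_linear z sgL.
have vn := gauge_nprS hk s b0; have wn n x y := twist_nprS zD zi sgL n x y sgn.
have wd := twist_derS zD zi sgL sgd.
apply: (linear_span_eq (z := z)) => [c x y|c x y|x|x|q x|q x|X].
- by rewrite tL vL.
- by rewrite vL wL.
- by rewrite td gauge_derS.
- by rewrite gauge_derS wd.
- by rewrite ts (linZ vL) (gauge_shS hk).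
- by rewrite (gauge_shS hk) (twist_shS zD sgL).
have [->|nX] := eqVneq X iL; last exact: H.
rewrite L_expr (linB tL) !(linB vL) (linB wL) (linZ tL) !(linZ vL) (linZ wL).
by rewrite tn td !gauge_derS wd !vn wn !H.
Qed.

Lemma tau_classification : exists (b : k) s, b != 0 /\
  ((forall x, gauge b s (tau x) = twist z id (gauge b s x)) \/
   (forall x, gauge b s (tau x) = twist z (@omegaA k) (gauge b s x))).
Proof.
case: tau_gens => -[q [c [c0 tJ tP tM]]].
(* Here τ^M G^+ is a nonzero multiple of t^(qM) G^+, so a period M > 0 forces q = 0. *)
- have q0 : q = 0.
    have [M M0 eM] := tf (T iP).
    have [C C0 iE] : exists2 C, C != 0 & iter M tau (T iP) = C *: mon (q *+ M) (gen iP).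
      elim: {M0 eM} M => [|n [C C0 IH]].
        by exists 1; rewrite ?oner_eq0 //= scale1r mulr0n.
      exists (C * (z (q *+ n) * c)); first by rewrite !mulf_neq0 ?(zeta_neq0 hxi hcomp).
      have e : mon (q *+ n) (gen iP) = shS (q *+ n) (T iP) by rewrite shS_mon addr0.
      by rewrite iterS IH (linZ tL) e ts tP shSZ shS_mon !scalerA mulrA addrC -mulrS.
    have := congr1 (fun x : AS => x@_0) eM; rewrite iE /= coef_scaleS !coef_mon eqxx.
    case: eqP => [/eqP|_]; last first.
      by rewrite mulr0n scaler0 => /esym/eqP; rewrite (negPf (gen_neq0 _)).
    by rewrite mulrn_eq0 eqn0Ngt M0 /= => /eqP.
  rewrite q0 oppr0 in tP tM.
  have [M M0 eM] := tf (T iP).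
  have cM : c ^+ M = 1.
    have iE n : iter n tau (T iP) = c ^+ n *: T iP.
      elim: n => [|n IH]; first by rewrite /= scale1r.
      by rewrite iterS IH (linZ tL) tP scalerA exprSr.
    move: eM; rewrite iE => /eqP; rewrite -subr_eq0 -{2}[T iP]scale1r -scalerBl scaler_eq0.
    case/orP => [|/eqP /mon_gen_neq0 //]; by rewrite subr_eq0 => /eqP.
  (* The root of unity c equals γ(t^r) / t^r for some r, and the gauge by t^r absorbs it. *)
  have [r zr] := zeta_root hxi hcomp M0 cM.
  exists 1, r; split; first exact: oner_neq0.
  left; apply: intertwine => //; first exact: oner_neq0.
  have vL := gauge_linear (1 : k) r; have idL : linear (fun a : A k => a) by [].
  have wL := twist_linear z idL; have wm := twist_mon z idL.
  elim/I4_ind => // _.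
  + by rewrite tJ gauge_J wm (zeta0 hxi hcomp) scale1r.
  + by rewrite tP (linZ vL) gauge_P (linZ wL) wm !scale1r add0r zr.
  by rewrite tM (linZ vL) gauge_M (linZ wL) wm invr1 !scale1r add0r (zetaN hxi hcomp) zr.
(* On G^+ the two sides are c b^-1 t^(q-s) G^- and b ζ(s) t^s G^-; equality means q = 2s and b^2 = c
   ζ(s)^-1. *)
pose s := q / 2%:R.
have qE : q = s + s by rewrite /s; field.
have [b bE] : exists b : k, b ^+ 2 = c * (z s)^-1.
  have [b] := @solve_monicpoly k 2 (nth 0 [:: c * (z s)^-1]) isT.
  by rewrite !big_ord_recl big_ord0 /= expr0 mulr1 mul0r !addr0 => e; exists b.
have zs0 := zeta_neq0 hxi hcomp s.
have b0 : b != 0.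
  apply/eqP => b0; move/eqP: bE; rewrite b0 expr0n /= eq_sym mulf_eq0 invr_eq0.
  by rewrite (negPf c0) (negPf zs0).
exists b, s; split=> //; right.
have oL := @omegaA_linear k.
have [_ [_ [_ [od on]]]] := @omegaA_conf_aut k.
apply: intertwine => //.
have vL := gauge_linear b s; have wL := twist_linear z oL; have wm := twist_mon z oL.
have cE : c = b ^+ 2 * z s by rewrite bE mulfVK.
elim/I4_ind => // _.
+ by rewrite tJ (linN vL) gauge_J wm (zeta0 hxi hcomp) scale1r !omegaA_gen monN.
+ rewrite tP (linZ vL) gauge_M gauge_P (linZ wL) wm !omegaA_gen !scalerA add0r.
  have -> : q - s = s by rewrite qE addrK.
  by rewrite cE; apply: (congr1 (fun x => x *: mon s (gen iM))); field; rewrite b0.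
rewrite tM (linZ vL) gauge_M gauge_P (linZ wL) wm !omegaA_gen !scalerA add0r.
have -> : - q + s = - s by rewrite qE opprD addrNK.
rewrite (zetaN hxi hcomp) cE; apply: (congr1 (fun x => x *: mon (- s) (gen iP))).
by field; rewrite b0 zs0.
Qed.
End Tau.
End Classification.

(** * Locally finite linear operators *)

Section LocallyFinite.
Variables (K : fieldType) (V : lmodType K) (f : V -> V).
Hypothesis fL : linear f.

Definition loc_finite x := exists2 M, (0 < M)%N & iter M f x = x.

Lemma iter_linear n : linear (iter n f).
Proof. by elim: n => [|n IH] c x y //=; rewrite IH fL. Qed.

Lemma iter_fixM M N x : iter M f x = x -> iter (N * M) f x = x.
Proof. by move=> e; elim: N => //= N IH; rewrite mulSn iterD IH e. Qed.

Lemma loc_finiteD x y : loc_finite x -> loc_finite y -> loc_finite (x + y).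
Proof.
move=> [M M0 eM] [N N0 eN]; exists (N * M)%N; first by rewrite muln_gt0 N0.
by rewrite (linD (iter_linear _)) iter_fixM // mulnC iter_fixM.
Qed.

Lemma loc_finite0 : loc_finite 0.
Proof. by exists 1%N => //=; exact: lin0. Qed.
End LocallyFinite.

(** * Descent: a form as the fixed points of a semilinear automorphism *)

Section Forms.
Variables (k : closedFieldType) (xi : nat -> k).
Hypothesis hk : [pchar k] =i pred0.
Hypothesis hxi : forall m : nat, (0 < m)%N -> m.-primitive_root (xi m).
Hypothesis hcomp : forall m n : nat, (0 < m)%N -> (0 < n)%N -> xi (m * n)%N ^+ n = xi m.
Local Notation AS := (AS k).
Local Notation z := (zeta xi).
Let zD := zetaD hxi hcomp.
Let zi := zeta_int hxi hcomp.

Lemma rsclS_mon (c : k) (n : int) (x : AS) :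
  rsclS (<< c *g n >> : laurent k) x = c *: shS n%:~R x.
Proof.
rewrite /rsclS msuppU; case: eqP => [->|_]; first by rewrite big_seq_fset0 scale0r.
by rewrite big_seq_fset1 mcoeffUU.
Qed.

Lemma rsclS_hom (v : AS -> AS) (r : laurent k) (x : AS) : linear v ->
  (forall p x, v (shS p x) = shS p (v x)) -> v (rsclS r x) = rsclS r (v x).
Proof.
move=> vL vs; rewrite /rsclS (lin_sum vL); apply: eq_bigr => n _.
by rewrite !sclSE (linZ vL) vs.
Qed.

Definition fracq (p : rat) : rat := p - (Num.floor p)%:~R.

Lemma fracq_itv p : 0 <= fracq p < 1.
Proof.
have /andP[h1 h2] := floor_itv p; rewrite intrD in h2.
by rewrite /fracq subr_ge0 h1 ltrBlDl.
Qed.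

Variables (F : lmodType (laurent k)) (parF : bool -> F -> Prop)
          (derF : F -> F) (nprF : nat -> F -> F -> F) (iota : F -> AS).
Hypothesis Fconf : is_conf (@derR k) parF derF nprF.
Hypothesis iota_lin : forall (r : laurent k) x y, iota (r *: x + y) = rsclS r (iota x) + iota y.
Hypothesis iota_par : forall b x, parF b x -> parS b (iota x).
Hypothesis iota_der : forall x, iota (derF x) = derS (iota x).
Hypothesis iota_npr : forall n x y, iota (nprF n x y) = nprS n (iota x) (iota y).
Hypothesis iota_surj : forall y : AS, exists s : seq (rat * F),
        y = \sum_(p <- s) shS p.1 (iota p.2).
Hypothesis iota_free : forall s : seq (rat * F),
        uniq (map fst s) -> (forall p, p \in s -> (0 <= p.1 < 1)%R) ->
        \sum_(p <- s) shS p.1 (iota p.2) = 0 ->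
        forall p, p \in s -> p.2 = 0.

Definition tmon (c : k) (n : int) : laurent k := << c *g n >>.

Lemma iotaD x y : iota (x + y) = iota x + iota y.
Proof.
have -> : x + y = (1 : laurent k) *: x + y by rewrite scale1r.
by rewrite iota_lin (_ : 1 = tmon 1 0) // rsclS_mon scale1r shS0.
Qed.
Lemma iota0 : iota 0 = 0.
Proof. by apply: (addrI (iota 0)); rewrite -iotaD !addr0. Qed.
Lemma iotaN x : iota (- x) = - iota x.
Proof. by apply/eqP; rewrite -addr_eq0 -iotaD addNr iota0. Qed.
Lemma iota_tmon c n x : iota (tmon c n *: x) = c *: shS n%:~R (iota x).
Proof. by rewrite -[_ *: x]addr0 iota_lin rsclS_mon iota0 addr0. Qed.
Lemma iota_sum (I : Type) (r : seq I) (P : pred I) (G : I -> F) :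
  iota (\sum_(i <- r | P i) G i) = \sum_(i <- r | P i) iota (G i).
Proof. exact: (big_morph iota iotaD iota0). Qed.

Definition elt (p : rat * F) : AS := shS p.1 (iota p.2).
(** A list of pairs (q, f) stands for the tensor Σ f ⊗ t^q in F ⊗ Ŝ. Weight 1 gives its image under
    Ψ, weight ζ the image under Ψ of its transform by id ⊗ γ. *)
Definition wsum (w : rat -> k) (l : seq (rat * F)) : AS := \sum_(p <- l) w p.1 *: elt p.

Lemma wsum_cat w l l' : wsum w (l ++ l') = wsum w l + wsum w l'.
Proof. exact: big_cat. Qed.

Lemma wsum_scale w c l : wsum w [seq (p.1, tmon c 0 *: p.2) | p <- l] = c *: wsum w l.
Proof.
rewrite /wsum big_map scaler_sumr; apply: eq_bigr => p _.
by rewrite /elt /= iota_tmon shS0 shSZ scaler_swap.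
Qed.

Lemma wsum1 l : wsum (fun=> 1) l = \sum_(p <- l) elt p.
Proof. by apply: eq_bigr => p _; rewrite scale1r. Qed.

(* The coordinates of an element in the R-basis (t^q), 0 <= q < 1, of k[t^Q]. *)
Definition normal (l : seq (rat * F)) : seq (rat * F) :=
  [seq (q, \sum_(p <- l | fracq p.1 == q) tmon 1 (Num.floor p.1) *: p.2)
  | q <- undup [seq fracq p.1 | p <- l]].

(** Moving the integral part of an exponent into F changes neither the tensor nor a weight that
    depends on q modulo Z only. *)
Lemma wsum_normal w l : (forall p, w (fracq p) = w p) -> wsum w (normal l) = wsum w l.
Proof.
move=> wf; rewrite /wsum big_map.
transitivity (\sum_(q <- undup [seq fracq p.1 | p <- l]) \sum_(p <- l | fracq p.1 == q) w p.1 *: elt p).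
  apply: eq_bigr => q _; rewrite /elt /= iota_sum (lin_sum (shS_linear q)) scaler_sumr.
  apply: eq_bigr => p /eqP <-; rewrite wf iota_tmon scale1r shSD.
  by rewrite /fracq subrK.
rewrite (exchange_big_dep xpredT) //=; apply: eq_big_seq => p pl.
have u := undup_uniq [seq fracq p.1 | p <- l].
have mem : fracq p.1 \in undup [seq fracq p.1 | p <- l].
  by rewrite mem_undup; exact: (map_f (fun p => fracq p.1) pl).
rewrite -big_filter (eq_filter (a2 := pred1 (fracq p.1))) => [|q]; last exact: eq_sym.
by rewrite filter_pred1_uniq // big_seq1.
Qed.

Lemma fst_normal l : map fst (normal l) = undup [seq fracq p.1 | p <- l].
Proof. by rewrite /normal -map_comp map_id_in. Qed.

Lemma normal_itv l p : p \in normal l -> 0 <= p.1 < 1.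
Proof.
move=> pl; have : p.1 \in map fst (normal l) by exact: map_f.
by rewrite fst_normal mem_undup => /mapP[q _ ->]; exact: fracq_itv.
Qed.

(** Relations survive the weighting: in normal form freeness makes every coordinate zero. Hence id ⊗
    γ descends along Ψ. *)
Lemma wsum_eq0 (w : rat -> k) l : (forall p, w (fracq p) = w p) ->
  \sum_(p <- l) elt p = 0 -> wsum w l = 0.
Proof.
move=> wf e; rewrite -(wsum_normal _ wf) /wsum big1_seq // => p /andP[_ pl].
have /eqP e0 : \sum_(p <- normal l) elt p == 0 by rewrite -wsum1 wsum_normal // wsum1 e.
rewrite /elt (iota_free _ (@normal_itv l) e0 pl) ?iota0 ?shS_zero ?scaler0 //.
by rewrite fst_normal undup_uniq.
Qed.

Lemma z_fracq p : z (fracq p) = z p.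
Proof. by rewrite /fracq zD -mulrNz zi mulr1. Qed.

(** Stated with a boolean equality so that [xchoose] can select a representing list. *)
Fact tau_ex y : exists l : seq (rat * F), y == \sum_(p <- l) elt p.
Proof. by have [l ->] := iota_surj y; exists l. Qed.

Definition ftau y := wsum z (xchoose (tau_ex y)).

Lemma ftauE l : ftau (\sum_(p <- l) elt p) = wsum z l.
Proof.
rewrite /ftau; set l' := xchoose _.
have /eqP e : \sum_(p <- l) elt p == \sum_(p <- l') elt p by exact: (xchooseP (tau_ex _)).
(* The difference of two representations is the list l followed by -l'. *)
have := @wsum_eq0 z (l ++ [seq (p.1, tmon (-1) 0 *: p.2) | p <- l']) z_fracq.
rewrite wsum_cat wsum_scale scaleN1r -wsum1 wsum_cat wsum_scale !wsum1 e scaleN1r subrr.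
by move=> /(_ erefl) /eqP; rewrite subr_eq0 => /eqP.
Qed.

Lemma ftau_linear : linear ftau.
Proof.
move=> c x y; have /eqP -> := xchooseP (tau_ex x); have /eqP -> := xchooseP (tau_ex y).
set l := xchoose _; set l' := xchoose _; rewrite !ftauE.
by rewrite -(wsum1 l) -wsum_scale -(wsum1 l') -wsum_cat wsum1 ftauE wsum_cat wsum_scale.
Qed.

Lemma ftau_elt p f : ftau (shS p (iota f)) = z p *: shS p (iota f).
Proof. by have := ftauE [:: (p, f)]; rewrite /wsum !big_seq1. Qed.

Lemma elt_ind (P : AS -> Prop) : P 0 -> (forall x y, P x -> P y -> P (x + y)) ->
  (forall p f, P (shS p (iota f))) -> forall x, P x.
Proof.
move=> P0 PD Pe x; have [l ->] := iota_surj x; apply: (big_ind P) => // -[p f] _; exact: Pe.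
Qed.

Lemma elt_linear_eq (f g : AS -> AS) : linear f -> linear g ->
  (forall p x, f (shS p (iota x)) = g (shS p (iota x))) -> f =1 g.
Proof.
move=> fL gL fg; apply: elt_ind => [|x y ex ey|//]; first by rewrite !lin0.
by rewrite !linD // ex ey.
Qed.

Lemma ftau_derS x : ftau (derS x) = derS (ftau x).
Proof.
move: x; apply: elt_linear_eq => [c x y|c x y|p f].
- by rewrite derS_linear ftau_linear.
- by rewrite ftau_linear derS_linear.
rewrite (derS_shS hk) -iota_der (linD ftau_linear) (linZ ftau_linear) !ftau_elt.
rewrite derSZ (derS_shS hk) -iota_der (z_sub_nat zD zi p 1) scalerDr.
by rewrite (scaler_swap (ratr p)).
Qed.

Lemma ftau_shS p x : ftau (shS p x) = z p *: shS p (ftau x).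
Proof.
apply: (elt_linear_eq (f := fun x => ftau (shS p x)) (g := fun x => z p *: shS p (ftau x))).
- by move=> c u v; rewrite shS_linear ftau_linear.
- by move=> c u v; rewrite ftau_linear shS_linear scalerDr scaler_swap.
by move=> q f; rewrite shSD !ftau_elt shSZ shSD zD scalerA.
Qed.

(** The products of elements of F stay in F, where [ftau] acts trivially; only integral shifts of
    the exponents p + q occur, and ζ does not see them. *)
Lemma ftau_nprS n x y : ftau (nprS n x y) = nprS n (ftau x) (ftau y).
Proof.
move: x; apply: elt_linear_eq => [c u v|c u v|p f].
- by rewrite nprS_linearl ftau_linear.
- by rewrite ftau_linear nprS_linearl.
move: y; apply: elt_linear_eq => [c u v|c u v|q g].
- by rewrite nprS_linearr ftau_linear.
- by rewrite ftau_linear nprS_linearr.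
have [N hN] := nprS_bounded (iota f) (iota g).
rewrite !ftau_elt (linZ (nprS_linearl _ _)) (linZ (nprS_linearr _ _)) nprS_shr.
rewrite (nprS_shl hk n p hN) ftau_shS (lin_sum ftau_linear) scalerA mulrC -scalerA.
apply: (congr1 (fun u => z q *: u)); rewrite (lin_sum (shS_linear q)).
rewrite [in RHS](lin_sum (shS_linear q)) scaler_sumr.
apply: eq_bigr => i _; rewrite (linZ ftau_linear) -iota_npr ftau_elt (z_sub_nat zD zi) !shSZ.
by rewrite scaler_swap.
Qed.

Lemma wsum_par w b l : (forall p, p \in l -> parF b p.2) -> parS b (wsum w l).
Proof.
move=> h; rewrite /wsum big_seq; apply: (big_ind (parS b)).
- exact: parS_zero.
- exact: parS_add.
by move=> p pl; apply: parS_scale; apply: parS_shS; apply: iota_par; exact: h.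
Qed.

Lemma parity_split l : exists l0 l1 : seq (rat * F),
  [/\ forall p, p \in l0 -> parF false p.2, forall p, p \in l1 -> parF true p.2
    & forall w, wsum w l = wsum w l0 + wsum w l1].
Proof.
have [[_ [_ [_ [split_par _]]]] _] := Fconf.
elim: l => [|[p f] l [l0 [l1 [h0 h1 hw]]]].
  by exists [::], [::]; split=> // w; rewrite /wsum !big_nil addr0.
have [f0 [f1 [pf0 pf1 ->]]] := split_par f.
exists ((p, f0) :: l0), ((p, f1) :: l1); split.
- by move=> q; rewrite inE => /orP[/eqP ->|/h0].
- by move=> q; rewrite inE => /orP[/eqP ->|/h1].
move=> w; have := hw w; rewrite /wsum !big_cons => ->.
by rewrite /elt /= iotaD shS_add scalerDr addrACA.
Qed.

Lemma parS_disjoint (x : AS) : parS false x -> parS true x -> x = 0.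
Proof.
move=> h0 h1; apply: ASP => q; rewrite coef_zeroS; apply/ffunP => Z; rewrite ffunE.
by case: (boolP (2 <= Z)%N) => hZ; [apply: h0|apply: h1]; rewrite ?hZ // (negPf hZ).
Qed.

(** In a homogeneous element the part of the representation of the wrong parity sums to zero, and by
    [wsum_eq0] it still does after weighting. *)
Lemma ftau_par b x : parS b x -> parS b (ftau x).
Proof.
have [l ->] := iota_surj x; rewrite -/(elt _); have [l0 [l1 [h0 h1 hw]]] := parity_split l.
move=> hx; rewrite (ftauE l) hw.
have := hw (fun=> 1); rewrite !wsum1 => e.
have q0 := wsum_par (fun=> 1) h0; have q1 := wsum_par (fun=> 1) h1; rewrite !wsum1 in q0 q1.
case: b hx => hx.
  have /(wsum_eq0 z_fracq) -> : \sum_(p <- l0) elt p = 0.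
    apply: parS_disjoint => //.
    have -> : \sum_(p <- l0) elt p = \sum_(p <- l) elt p - \sum_(p <- l1) elt p by rewrite e addrK.
    by apply: parS_add => //; exact: parS_opp.
  by rewrite add0r; exact: wsum_par.
have /(wsum_eq0 z_fracq) -> : \sum_(p <- l1) elt p = 0.
  apply: parS_disjoint => //.
  have -> : \sum_(p <- l1) elt p = \sum_(p <- l) elt p - \sum_(p <- l0) elt p by rewrite e addrC addKr.
  by apply: parS_add => //; exact: parS_opp.
by rewrite addr0; exact: wsum_par.
Qed.

Lemma zeta_finite_order q : exists2 M, (0 < M)%N & z q ^+ M = 1.
Proof.
exists `|denq q|%N; first exact: absz_denq_gt0.
rewrite -(zetaMn hxi hcomp) -mulr_natr.
have -> : (`|denq q|%N)%:R = (denq q)%:~R :> rat by rewrite -[in RHS]absz_denq.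
by rewrite -{1}[q]divq_num_den divfK ?zi // intr_eq0 denq_eq0.
Qed.

Lemma ftau_loc_finite x : loc_finite ftau x.
Proof.
move: x; apply: elt_ind => [|x y|p f].
- exact: (loc_finite0 ftau_linear).
- exact: (loc_finiteD ftau_linear).
have [M M0 zM] := zeta_finite_order p; exists M => //.
suff -> n : iter n ftau (shS p (iota f)) = z p ^+ n *: shS p (iota f) by rewrite zM scale1r.
elim: n => [|n IH]; first by rewrite /= scale1r.
by rewrite iterS IH (linZ ftau_linear) ftau_elt scalerA -exprSr.
Qed.

Lemma ftau_iota f : ftau (iota f) = iota f.
Proof. by have := ftau_elt 0 f; rewrite shS0 (zeta0 hxi hcomp) scale1r. Qed.

Lemma iota_inj : injective iota.
Proof.
move=> f g e; apply/eqP; rewrite -subr_eq0; apply/eqP.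
apply: (iota_free (s := [:: (0, f - g)]) _ _ _ (mem_head _ _)) => //.
- by move=> p; rewrite inE => /eqP ->.
by rewrite big_seq1 /= shS0 iotaD iotaN e subrr.
Qed.

(** The coordinates f_q of a fixed point, 0 <= q < 1, satisfy (ζ(q) - 1) f_q = 0. Since the kernel
    of ζ is Z, only q = 0 survives. *)
Lemma ftau_fixed x : ftau x = x -> exists f, iota f = x.
Proof.
have [l ->] := iota_surj x; rewrite -/(elt _) => e; pose l' := normal l.
have e1 : \sum_(p <- l) elt p = \sum_(p <- l') elt p.
  by rewrite -!wsum1 wsum_normal.
have e2 : wsum z l' = \sum_(p <- l') elt p by rewrite -ftauE -e1.
(* These are the coordinates of [ftau x - x], which is zero. *)
pose m := [seq (p.1, tmon (z p.1 - 1) 0 *: p.2) | p <- l'].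
have m0 : \sum_(p <- m) elt p = 0.
  rewrite big_map; transitivity (wsum z l' - \sum_(p <- l') elt p); last by rewrite e2 subrr.
  rewrite /wsum -sumrB; apply: eq_bigr => p _.
  by rewrite /elt /= iota_tmon shS0 shSZ scalerBl scale1r.
have zero p : p \in l' -> p.1 != 0 -> p.2 = 0.
  move=> pl p0; apply: iota_inj; rewrite iota0.
  have mem : (p.1, tmon (z p.1 - 1) 0 *: p.2) \in m by exact: (map_f _ pl).
  have := iota_free _ _ m0 mem; rewrite /= => /(_ _ _) h.
  have {h} : tmon (z p.1 - 1) 0 *: p.2 = 0.
    apply: h; first by rewrite /m -map_comp fst_normal undup_uniq.
    by move=> q /mapP[q' /normal_itv qi ->].
  move/(congr1 iota); rewrite iota_tmon iota0 shS0 => /eqP; rewrite scaler_eq0.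
  case/orP => [|/eqP //]; rewrite subr_eq0 => /eqP /(zeta_eq1 hxi) [i pi].
  have /andP[h0 h1] := normal_itv pl; case/eqP: p0; rewrite pi.
  rewrite pi ler0z in h0; rewrite pi ltrz1 in h1.
  by clear pi; case: i h0 h1 => [[|n]|n].
exists (\sum_(p <- l' | p.1 == 0) p.2); rewrite iota_sum e1 [RHS](bigID (fun p => p.1 == 0)) /=.
rewrite [X in _ = _ + X]big1_seq ?addr0 => [|p /andP[p0 pl]].
  by apply: eq_bigr => p /eqP p0; rewrite /elt p0 shS0.
by rewrite /elt zero // iota0 shS_zero.
Qed.
End Forms.

(** * Loop algebras as fixed points, and the final statements *)

Section Loops.
Variables (k : closedFieldType) (xi : nat -> k).
Hypothesis hk : [pchar k] =i pred0.
Hypothesis hxi : forall m : nat, (0 < m)%N -> m.-primitive_root (xi m).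
Hypothesis hcomp : forall m n : nat, (0 < m)%N -> (0 < n)%N -> xi (m * n)%N ^+ n = xi m.
Local Notation A := (A k).
Local Notation AS := (AS k).
Local Notation z := (zeta xi).
Local Notation T X := (mon 0 (gen k X)).
Let zD := zetaD hxi hcomp.
Let zi := zeta_int hxi hcomp.

Lemma int_over_nat (q : rat) (m : nat) (i : int) : (0 < m)%N -> q *+ m = i%:~R ->
  q = i%:~R / m%:R.
Proof. by move=> m0 <-; rewrite -(mulr_natr q m) mulfK // pnatr_eq0 -lt0n. Qed.

(** Both sides express s x_q = ζ(q) x_q, with [s'] the inverse of s. If x_q is nonzero, s^m = id
    gives ζ(q)^m = 1, so mq is an integer; this recovers the restriction on exponents. *)
Lemma loopP_fixed m (s s' : A -> A) x : (0 < m)%N -> linear s -> linear s' ->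
  cancel s s' -> cancel s' s -> (forall a, iter m s a = a) ->
  loopP xi m s x <-> twist z s' x = x.
Proof.
move=> m0 sL sL' sK sK' sm; split=> [lx|fx].
  apply: ASP => q; rewrite (coef_twist z sL'); have [h1 h2] := lx q.
  case: (boolP (denq (q *+ m) == 1)) => [/eqP d1|d1].
    have qE : q = (numq (q *+ m))%:~R / m%:R.
      by apply: int_over_nat => //; rewrite -{1}[q *+ m]divq_num_den d1 divr1.
    have := h1 _ qE; rewrite -(zeta_frac hcomp) // -qE => e.
    by rewrite -(linZ sL') -e sK.
  rewrite h2 ?(lin0 sL') ?scaler0 // => i qE; case/negP: d1.
  by rewrite qE -(mulr_natr (_ / _) m) divfK ?denq_int // pnatr_eq0 -lt0n.
have sx q : s x@_q = z q *: x@_q.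
  by rewrite -{1}fx (coef_twist z sL') (linZ sL) sK'.
move=> q; split=> [i qE|nq]; first by rewrite sx qE (zeta_frac hcomp).
have iE n : iter n s x@_q = z q ^+ n *: x@_q.
  elim: n => [|n IH]; first by rewrite /= scale1r.
  by rewrite iterS IH (linZ sL) sx scalerA exprSr.
apply/eqP; apply: contraT => x0.
have : z q ^+ m = 1.
  have /eqP := sm x@_q; rewrite iE -subr_eq0 -{2}[x@_q]scale1r -scalerBl scaler_eq0.
  by rewrite (negPf x0) orbF subr_eq0 => /eqP.
rewrite -(zetaMn hxi hcomp) => /(zeta_eq1 hxi) [i /(int_over_nat m0) qE].
by case: (nq i).
Qed.

Lemma id_linear : linear (fun a : A => a). Proof. by []. Qed.

Lemma loop_id_fixed x : loopP xi 1 id x <-> twist z id x = x.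
Proof. by apply: loopP_fixed => //; exact: id_linear. Qed.

Lemma loop_omega_fixed x : loopP xi 2 (@omegaA k) x <-> twist z (@omegaA k) x = x.
Proof.
by apply: loopP_fixed => //; [exact: omegaA_linear..|exact: omegaAK|exact: omegaAK|exact: omegaAK].
Qed.

Section GaugeIso.
Variables (b : k) (s0 : rat) (tau : AS -> AS) (sg : A -> A) (Q : AS -> Prop).
Hypothesis b0 : b != 0.
Hypothesis inter : forall x, gauge b s0 (tau x) = twist z sg (gauge b s0 x).
Hypothesis QE : forall x, Q x <-> twist z sg x = x.
Local Notation v := (gauge b s0).
Local Notation v' := (gauge b^-1 (- s0)).

Lemma gaugeK' : cancel v' v.
Proof. by have := gaugeK hk (- s0) (invr_neq0 b0); rewrite invrK opprK. Qed.

Lemma gauge_fixed x : tau x = x -> Q (v x).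
Proof. by move=> e; apply/QE; rewrite -inter e. Qed.

Lemma gauge_fixed_surj y : Q y -> tau (v' y) = v' y.
Proof.
by move/QE => e; apply: (can_inj (gaugeK hk s0 b0)); rewrite inter gaugeK' e.
Qed.

Lemma gauge_kiso (P : AS -> Prop) : (forall x, P x <-> tau x = x) -> kiso P Q v.
Proof.
move=> PE; have vK := gaugeK hk s0 b0.
split; first by move=> x /PE; exact: gauge_fixed.
split; first by move=> y Qy; exists (v' y); [apply/PE; exact: gauge_fixed_surj|exact: gaugeK'].
split; first by move=> x y _ _; exact: (can_inj vK).
split; first by move=> c x y _ _; exact: gauge_linear.
split; first by move=> c x _; exact: gauge_par.
split; first by move=> x _; exact: gauge_derS.
by move=> n x y _ _; exact: gauge_nprS.
Qed.

Lemma gauge_riso (F : lmodType (laurent k)) parF derF nprF (iota : F -> AS) :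
  (forall (r : laurent k) x y, iota (r *: x + y) = rsclS r (iota x) + iota y) ->
  (forall b x, parF b x -> parS b (iota x)) ->
  (forall x, iota (derF x) = derS (iota x)) ->
  (forall n x y, iota (nprF n x y) = nprS n (iota x) (iota y)) ->
  injective iota -> (forall f, tau (iota f) = iota f) ->
  (forall x, tau x = x -> exists f, iota f = x) ->
  riso parF derF nprF Q (v \o iota).
Proof.
move=> il ip id inp ii tfix tsurj; have vK := gaugeK hk s0 b0.
have vL := gauge_linear b s0.
split; first by move=> f /=; exact: gauge_fixed.
split.
  by move=> y /gauge_fixed_surj /tsurj [f fE]; exists f; rewrite /= fE gaugeK'.
split; first by move=> f g /= /(can_inj vK) /ii.
split; first by move=> r x y /=; rewrite il (linD vL) (rsclS_hom _ _ vL (gauge_shS hk b s0)).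
split; first by move=> c x /ip /=; exact: gauge_par.
split; first by move=> x /=; rewrite id gauge_derS.
by move=> n x y /=; rewrite inp (gauge_nprS hk).
Qed.
End GaugeIso.

Lemma conf_autA_iter (s : A -> A) n : conf_autA s ->
  [/\ linear (iter n s), forall a, iter n s (derA a) = derA (iter n s a),
   forall b a, parA b a -> parA b (iter n s a)
   & forall j a a', iter n s (nprA j a a') = nprA j (iter n s a) (iter n s a')].
Proof.
move=> [_ [sL [sp [sd sn]]]]; split.
- by elim: n => [|n IH] c a a' //=; rewrite IH sL.
- by elim: n => [|n IH] a //=; rewrite IH sd.
- by elim: n => [|n IH] b a pa //=; apply: sp; exact: IH.
by elim: n => [|n IH] j a a' //=; rewrite IH sn.
Qed.

Lemma loop_classification (m : nat) (s : A -> A) : (0 < m)%N -> conf_autA s ->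
  (forall a, iter m s a = a) ->
  (exists phi, kiso (loopP xi m s) (loopP xi 1 id) phi) \/
  (exists phi, kiso (loopP xi m s) (loopP xi 2 (@omegaA k)) phi).
Proof.
move=> m0 sc sm; have [sL' sd' sp' sn'] := conf_autA_iter m.-1 sc.
have sL : linear s by case: sc => _ [].
(* The inverse of σ is the power σ^(m-1), so its compatibility with the structure comes from
   [conf_autA_iter]. *)
pose s' := iter m.-1 s.
have sK : cancel s s' by move=> a; rewrite /s' -iterSr prednK.
have sK' : cancel s' s by move=> a; rewrite /s' -iterS prednK.
have PE x := loopP_fixed x m0 sL sL' sK sK' sm.
have tL := twist_linear z sL'.
have tf x : exists2 M, (0 < M)%N & iter M (twist z s') x = x.
  rewrite -/(loc_finite _ x); move: x; apply: AS_ind => [|x y|q a].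
  - exact: (loc_finite0 tL).
  - exact: (loc_finiteD tL).
  have [M M0 zM] := zeta_finite_order hxi hcomp q; exists (M * m)%N; first by rewrite muln_gt0 M0.
  have iE n : iter n (twist z s') (mon q a) = z q ^+ n *: mon q (iter n s' a).
    elim: n => [|n IH]; first by rewrite /= scale1r.
    by rewrite iterS IH (linZ tL) (twist_mon z sL') scalerA -exprSr.
  (* M removes the scalar ζ(q) and m removes σ^-1, so Mm is a period of a ⊗ t^q. *)
  rewrite iE exprM zM expr1n scale1r; apply: (congr1 (mon q)).
  have s'm : iter m s' a = a.
    have H n c : iter n s' (iter n s c) = c by elim: n c => // n IH c; rewrite iterSr /= sK IH.
    by rewrite -{1}(sm a) H.
  exact: iter_fixM.
have [b [s0 [b0 H]]] := tau_classification hk hxi hcomp tL (twist_derS zD zi sL' sd')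
  (twist_shS zD sL') (fun n x y => twist_nprS zD zi sL' n x y sn')
  (fun b x => twist_par z sL' sp') tf.
by case: H => H; [left|right]; exists (gauge b s0); apply: (gauge_kiso b0 H) => //;
  [exact: loop_id_fixed|exact: loop_omega_fixed].
Qed.

(** By [eigenpair] the image of J would be J or -J, but the twist by ω changes the sign of J, while
    it fixes every element of the target. *)
Lemma loops_not_iso : ~ (exists phi, kiso (loopP xi 1 id) (loopP xi 2 (@omegaA k)) phi).
Proof.
move=> [phi [pQ [_ [pinj [pL [ppar [_ pn]]]]]]].
have PT X : loopP xi 1 id (T X).
  by apply/loop_id_fixed; rewrite (twist_mon z id_linear) (zeta0 hxi hcomp) scale1r.
have P0 : loopP xi 1 id 0 by apply/loop_id_fixed; exact: (lin0 (twist_linear z id_linear)).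
have phi0 : phi 0 = 0.
  have := pL 1 0 0 P0 P0; rewrite !sclSE !scale1r addr0 => /eqP.
  by rewrite -subr_eq0 opprD addNKr oppr_eq0 => /eqP.
have yn : phi (T iP) <> 0.
  move=> e; apply: (@mon_gen_neq0 k 0 iP); apply: (pinj _ _ (PT _) P0).
  by rewrite e phi0.
have n0 : nprS 0 (phi (T iJ)) (phi (T iP)) = phi (T iP) by rewrite -pn // (npr_JP hk).
have nS n : nprS n.+1 (phi (T iJ)) (phi (T iP)) = 0 by rewrite -pn // (npr_JP hk).
have hJ : parS false (phi (T iJ)) by apply: ppar => //; exact: parS_gen.
have hP : parS true (phi (T iP)) by apply: ppar => //; exact: parS_gen.
have /loop_omega_fixed fJ := pQ _ (PT iJ).
have oL := @omegaA_linear k.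
by case: (eigenpair hk hJ hP yn n0 nS) => -[e _]; move: fJ; rewrite e (twist_mon z oL)
  (zeta0 hxi hcomp) scale1r ?(linN oL) !omegaA_gen ?opprK => e';
  apply: (mon_J_sign hk); rewrite e'.
Qed.

Lemma form_classification (F : lmodType (laurent k)) (parF : bool -> F -> Prop)
    (derF : F -> F) (nprF : nat -> F -> F -> F) :
  is_conf (@derR k) parF derF nprF -> is_form parF derF nprF ->
  (exists phi, riso parF derF nprF (loopP xi 1 id) phi) \/
  (exists phi, riso parF derF nprF (loopP xi 2 (@omegaA k)) phi).
Proof.
move=> Fc [iota [il [ip [id [inp [isurj iinj]]]]]].
have tL := ftau_linear hxi hcomp il isurj iinj.
have [b [s0 [b0 H]]] := tau_classification hk hxi hcomp tL
  (ftau_derS hk hxi hcomp il id isurj iinj) (ftau_shS hxi hcomp il isurj iinj)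
  (ftau_nprS hk hxi hcomp il inp isurj iinj) (ftau_par hxi hcomp Fc il ip isurj iinj)
  (ftau_loc_finite hxi hcomp il isurj iinj).
have ii := iota_inj il iinj.
have tfix := ftau_iota hxi hcomp il isurj iinj.
have tsurj x := @ftau_fixed _ _ hxi hcomp _ _ il isurj iinj x.
case: H => H; [left|right]; exists (gauge b s0 \o iota); apply: (gauge_riso b0 H) => //.
- exact: loop_id_fixed.
- exact: loop_omega_fixed.
Qed.
End Loops.

Theorem theorem4p20 (k : closedFieldType) (hk : [pchar k] =i pred0)
  (xi : nat -> k)
  (hxi : forall m : nat, (0 < m)%N -> m.-primitive_root (xi m))
  (hcomp : forall m n : nat, (0 < m)%N -> (0 < n)%N -> xi (m * n)%N ^+ n = xi m) :
  (* ω is an automorphism of order two *)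
  (conf_autA (@omegaA k) /\ (forall a, omegaA (omegaA a) = a :> A k)) /\
  (* every twisted loop algebra is k-isomorphic to L(A,id) or L(A,ω) *)
  (forall (m : nat) (s : A k -> A k), (0 < m)%N -> conf_autA s ->
     (forall a, iter m s a = a) ->
     (exists phi, kiso (loopP xi m s) (loopP xi 1 id) phi) \/
     (exists phi, kiso (loopP xi m s) (loopP xi 2 (@omegaA k)) phi)) /\
  (* L(A,id) and L(A,ω) are not isomorphic *)
  ~ (exists phi, kiso (loopP xi 1 id) (loopP xi 2 (@omegaA k)) phi) /\
  (* every Ŝ/R-form of A ⊗_k R is R-isomorphic to L(A,id) or L(A,ω) *)
  (forall (F : lmodType (laurent k)) (parF : bool -> F -> Prop)
          (derF : F -> F) (nprF : nat -> F -> F -> F),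
     is_conf (@derR k) parF derF nprF -> is_form parF derF nprF ->
     (exists phi, riso parF derF nprF (loopP xi 1 id) phi) \/
     (exists phi, riso parF derF nprF (loopP xi 2 (@omegaA k)) phi)).
Proof.
split; first by split; [exact: omegaA_conf_aut|exact: omegaAK].
split; first by move=> m s; exact: loop_classification.
split; first exact: loops_not_iso.
by move=> F parF derF nprF; exact: form_classification.
Qed.
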